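(* Let $$\omega:=\sum_{l\ge 0}(-1)^l c_l\;\epsilon|\epsilon^{\,n-1+nl+l}\,u^l\in HC^-_*(A_n),\qquad c_0=1,\quad c_l:=\prod_{j=0}^{l-1}\big(n+j(n+1)\big)\ \ (l\ge 1),$$ be the weight-preserving Calabi-Yau structure on $A_n$, and let $\mathcal{A}_n$ be the versal deformation of $A_n$ over $R=\mathbb{K}[[t_0,\dots,t_{n-1}]]$. Then there exists a unique categorical primitive form $\zeta\in HC^-_*(\mathcal{A}_n)$ lifting $\omega$.
   Context: $\mathbb{K}$ is a field of characteristic $0$ and $n\ge 1$ an integer. Shifted sign conventions are used for $A_\infty$ algebras (all structure maps $\mu_k$, $k\ge 0$, have degree $1$ with respect to the shifted grading, and all signs $\pm$ below are the resulting Koszul signs). Hochschild chains are graded homologically, so $b$ has degree $-1$ and $B$ degree $+1$. **The algebra $A_n$.** $A_n=\mathrm{span}(\mathbf 1,\epsilon)$ is the $\mathbb{Z}/2\mathbb{Z}$-graded $A_\infty$ algebra with $\mathbf 1$ even and a strict unit, $\epsilon$ odd, whose only other non-zero operation is $\mu_{n+1}(\epsilon,\dots,\epsilon)=\frac1{n+1}\mathbf 1$. It is cyclic for the odd pairing with $\langle\mathbf 1,\epsilon\rangle=1$. It is the minimal model of the endomorphism dg algebra of the generator of the category of matrix factorizations of $\frac1{n+1}x^{n+1}$. **The versal deformation.** $R=\mathbb{K}[[t_0,\dots,t_{n-1}]]$, with maximal ideal $\mathfrak m$. $\mathcal A_n=A_n\otimes R$ is the weakly curved $A_\infty$ algebra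 over $R$ with strict unit $\mathbf 1$ and $\mu_0=t_0\mathbf 1$, $\mu_k(\epsilon^{\otimes k})=t_k\mathbf 1$ for $1\le k\le n-1$, $\mu_{n+1}(\epsilon^{\otimes n+1})=\frac1{n+1}\mathbf 1$ (besides the operations forced by the strict unit). The pairing of $A_n$ is extended $R$-linearly. **Chains.** $CC_*$ denotes the reduced Hochschild chain complex (the unit is killed in all slots except the $0$-th), with Hochschild differential $b$ and Connes operator $B$; chains are written $a_0|a_1|\cdots|a_k$, and $\mathbf 1|\epsilon^k$, $\epsilon|\epsilon^k$ have $k$ copies of $\epsilon$ after the bar. For $\mathcal A_n$, $CC_*(\mathcal A_n):=\varprojlim_N CC_*(\mathcal A_n/\mathfrak m^N\mathcal A_n)$. The negative cyclic homology $HC^-_*$ is the homology of $(CC_*[[u]],b+uB)$ and the periodic cyclic homology $HP_*$ that of $(CC_*((u)),b+uB)$, in the $\mathfrak m$-adically completed sense for $\mathcal A_n$. $HH_*$ is Hochschild homology, and $\pi:HC^-_*\to HH_*$ is the map setting $u=0$. On $A_n$: $b(\mathbf 1|\epsilon^k)=0$; $b(\epsilon|\epsilon^k)=0$ for $k<n$ and $\mathbf 1|\epsilon^{k-n}$ for $k\ge n$; $B(\mathbf 1|\epsilon^k)=0$; $B(\epsilon|\epsilon^k)=(k+1)\,\mathbf 1|\epsilon^{k+1}$. Weights on $CC_*(A_n)[[u]]$: $\mathrm{wt}(\mathbf 1|\epsilon^k)=\frac{2k}{n+1}$, $\mathrm{wt}(\epsilon|\epsilon^k)=\frac{2k+1-n}{n+1}$,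 $\mathrm{wt}(u)=-2$; $\omega$ is homogeneous and lifts $[\epsilon|\epsilon^{n-1}]$. **Mukai and higher residue pairings.** Put $c(a_1,\dots,a_{k+1})=\langle\mu_k(a_1,\dots,a_k),a_{k+1}\rangle$, let $\{e_s\}$ be a basis of the algebra over the ground ring and $\{e^s\}$ the dual basis for the pairing. The chain-level Mukai pairing is $$\langle a_0|\cdots|a_i,\,b_0|\cdots|b_j\rangle_{\rm Muk}=\sum\pm\, c(a_{q+1},\dots,a_i,a_0,\dots,a_p,e_s,b_{p'+1},\dots,b_{q'},e_t)\;c(b_{q'+1},\dots,b_j,b_0,\dots,b_{p'},e^s,a_{p+1},\dots,a_q,e^t),$$ summed over $0\le p\le q\le i$, $0\le p'\le q'\le j$, and $s,t$. The higher residue pairing is $\langle \alpha u^i,\beta u^j\rangle_{\rm hres}=(-1)^i\langle\alpha,\beta\rangle_{\rm Muk}u^{i+j}$; it induces $HC^-_*(\mathcal A_n)\otimes HC^-_*(\mathcal A_n)\to R[[u]]$ and a pairing on $HP_*$ with values in Laurent series in $u$. **Connections.** For a Hochschild cochain $\varphi$, $$b^{1|1}(\varphi;a_0|\cdots|a_k)=\sum_{0\le j\le p\le q\le r\le k}\pm\mu(a_{p+1},\dots,a_q,\varphi(a_{q+1},\dots,a_r),a_{r+1},\dots,a_k,a_0,\dots,a_j)|a_{j+1}|\cdots|a_p,$$ $$B^{1|1}(\varphi;a_0|\cdots|a_k)=\sum_{0\le p\le q\le r\le k}\pm\mathbf 1|a_{p+1}|\cdots|a_q|\varphi(a_{q+1},\dots,a_r)|a_{r+1}|\cdots|a_k|a_0|\cdots|a_p.$$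 For $v\in\mathrm{Der}(R)$, $\mathrm{KS}(v)$ is the class in $HH^*(\mathcal A_n)$ of the cochain $v(\mu)$ (derivative of the structure constants), and the Getzler-Gauss-Manin connection is $\nabla_v=\nabla_v^{GGM}=v-u^{-1}b^{1|1}(v(\mu);-)-B^{1|1}(v(\mu);-)$. Here $\mathrm{KS}:\mathrm{Der}(R)\to HH^*(\mathcal A_n)$ is an isomorphism (versality). With $\Gamma(a_0|\cdots|a_k)=-k\,a_0|\cdots|a_k$ and $\kappa=\prod_k(2-k)\mu_k$, the $u$-connection is $$\nabla_{\partial/\partial u}=\frac{\partial}{\partial u}+\frac{\Gamma}{2u}+\frac{B^{1|1}(\kappa;-)}{2u}+\frac{b^{1|1}(\kappa;-)}{2u^2},\qquad \nabla_{u\partial/\partial u}=u\nabla_{\partial/\partial u}.$$ **Categorical primitive form.** An element $\zeta\in HC^-_*(\mathcal A_n)$ is a categorical primitive form (lifting $\omega$) if: - P0: the restriction of $\zeta$ to the central fiber $t=0$ equals $\omega$; - P1: the map $\mathrm{Der}(R)\to HC^-_*(\mathcal A_n)/u\,HC^-_*(\mathcal A_n)=HH_*(\mathcal A_n)$, $v\mapsto\pi(u\nabla_v\zeta)$, is an isomorphism; - P2: $\langle u\nabla_{v_1}\zeta,u\nabla_{v_2}\zeta\rangle_{\rm hres}\in R$ for all $v_1,v_2\in\mathrm{Der}(R)$; - P3: $\langle u\nabla_{v_1}u\nabla_{v_2}\zeta,u\nabla_{v_3}\zeta\rangle_{\rm hres}\in R\oplus uR$ for all $v_1,v_2,v_3\in\mathrm{Der}(R)$;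 - P4: with $E:=\mathrm{KS}^{-1}([\mu])\in\mathrm{Der}(R)$, where $[\mu]$ is the class of the structure map itself, there is a constant $r\in\mathbb{K}$ with $(\nabla_{u\partial/\partial u}+\nabla_E)\zeta=r\zeta$.
   Formalization: In P4, [μ] is read as the class of μ restricted to reduced inputs (powers of ε only), so E is the Euler field Σ(1−k/(n+1))t_k∂/∂t_k; the class of the full μ in the unreduced complex is twice this, and P4 would then have no solution. *)

(* Defs.v *)
From HB Require Import structures.
From mathcomp Require Import all_boot all_order all_algebra.
From mathcomp Require Import mpoly.
From mathcomp Require Import boolp classical_sets functions cardinality fsbigop.

Set Implicit Arguments.
Unset Strict Implicit.
Unset Printing Implicit Defensive.

Import Order.TTheory GRing.Theory.

Local Open Scope classical_set_scope.
Local Open Scope ring_scope.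

Record mps (n : nat) (K : comNzRingType) := MPS { coefs : 'X_{1..n} -> K }.

Section PowerSeriesRing.
Variables (n : nat) (K : comNzRingType).
Local Notation R := (mps n K).
Implicit Types (f g h : R) (m : 'X_{1..n}).

Lemma mpsP f g : coefs f =1 coefs g -> f = g.
Proof. by case: f g => [f] [g] /= fg; congr MPS; apply/funext. Qed.

HB.instance Definition _ := gen_eqMixin R.
HB.instance Definition _ := gen_choiceMixin R.

Definition mps_const (a : K) : R := MPS (fun m => if m == 0%MM then a else 0).
Definition mps_var (i : 'I_n) : R := MPS (fun m => (m == U_(i)%MM)%:R).
Definition mps_opp f : R := MPS (fun m => - coefs f m).
Definition mps_add f g : R := MPS (fun m => coefs f m + coefs g m).
Definition mps_scale (a : K) f : R := MPS (fun m => a * coefs f m).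
(* same convolution as in mcoeffM *)
Definition mps_mul f g : R :=
  MPS (fun m => \sum_(k : 'X_{1..n < (mdeg m).+1, (mdeg m).+1}
                       | m == (k.1 + k.2)%MM) coefs f k.1 * coefs g k.2).

Fact mps_addA : associative mps_add.
Proof. by move=> f g h; apply: mpsP => m /=; rewrite addrA. Qed.
Fact mps_addC : commutative mps_add.
Proof. by move=> f g; apply: mpsP => m /=; rewrite addrC. Qed.
Fact mps_add0 : left_id (mps_const 0) mps_add.
Proof. by move=> f; apply: mpsP => m /=; rewrite if_same add0r. Qed.
Fact mps_addN : left_inverse (mps_const 0) mps_opp mps_add.
Proof. by move=> f; apply: mpsP => m /=; rewrite if_same addNr. Qed.

HB.instance Definition _ :=
  GRing.isZmodule.Build R mps_addA mps_addC mps_add0 mps_addN.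

Definition mps_trunc d f : {mpoly K[n]} :=
  \sum_(m : 'X_{1..n < d}) coefs f m *: 'X_[m].

Lemma mcoeff_trunc d f m :
  (mps_trunc d f)@_m = if (mdeg m < d)%N then coefs f m else 0.
Proof.
rewrite /mps_trunc raddf_sum /=; case: ifPn => md.
  rewrite (bigD1 (BMultinom md)) //= mcoeffZ mcoeffX eqxx mulr1.
  rewrite big1 ?addr0 // => k /negP km.
  rewrite mcoeffZ mcoeffX; case: eqP => [E|_]; last by rewrite mulr0.
  by case: km; apply/eqP/val_inj.
rewrite big1 // => k _; rewrite mcoeffZ mcoeffX.
case: eqP => [E|_]; last by rewrite mulr0.
by move: md; rewrite -E bmdeg.
Qed.

Lemma coefs_mul d f g m : (mdeg m < d)%N ->
  coefs (mps_mul f g) m = (mps_trunc d f * mps_trunc d g)@_m.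
Proof.
move=> md; rewrite mcoeffM /=; apply: eq_bigr => -[k1 k2] /= _.
by rewrite !mcoeff_trunc // !(leq_trans (bmdeg _)).
Qed.

Lemma trunc_mul d f g h m : (mdeg m < d)%N ->
  (mps_trunc d (mps_mul f g) * mps_trunc d h)@_m =
  (mps_trunc d f * mps_trunc d g * mps_trunc d h)@_m.
Proof.
move=> md; rewrite !mcoeffM; apply: eq_bigr => -[k1 k2] /= _.
have kd : (mdeg k1 < d)%N by rewrite (leq_trans (bmdeg k1)).
by rewrite mcoeff_trunc kd (coefs_mul _ _ kd).
Qed.

Fact mps_mulC : commutative mps_mul.
Proof.
by move=> f g; apply: mpsP => m; rewrite !(@coefs_mul (mdeg m).+1) // mulrC.
Qed.

Fact mps_mulA : associative mps_mul.
Proof.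
move=> f g h; apply: mpsP => m.
rewrite [mps_mul f _]mps_mulC !(@coefs_mul (mdeg m).+1) // !trunc_mul //.
by rewrite mulrC mulrA.
Qed.

Fact mps_mul1 : left_id (mps_const 1) mps_mul.
Proof.
move=> f; apply: mpsP => m; rewrite (@coefs_mul (mdeg m).+1) //.
have -> : mps_trunc (mdeg m).+1 (mps_const 1) = 1.
  apply/mpolyP => k; rewrite mcoeff_trunc mcoeff1 /=.
  by case: eqP => [->|]; rewrite ?mdeg0 ?if_same.
by rewrite mul1r mcoeff_trunc ltnSn.
Qed.

Fact mps_mulDl : left_distributive mps_mul mps_add.
Proof.
move=> f g h; apply: mpsP => m /=; rewrite -big_split /=.
by apply: eq_bigr => k _; rewrite mulrDl.
Qed.

Fact mps_oner_neq0 : mps_const 1 != 0.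
Proof.
apply/eqP => /(congr1 (fun f => coefs f 0%MM)) /=.
by rewrite eqxx => /eqP; rewrite oner_eq0.
Qed.

HB.instance Definition _ := GRing.Zmodule_isComNzRing.Build R
  mps_mulA mps_mulC mps_mul1 mps_mulDl mps_oner_neq0.

Fact mps_scaleA a b f : mps_scale a (mps_scale b f) = mps_scale (a * b) f.
Proof. by apply: mpsP => m /=; rewrite mulrA. Qed.
Fact mps_scale1 : left_id 1 mps_scale.
Proof. by move=> f; apply: mpsP => m /=; rewrite mul1r. Qed.
Fact mps_scaleDr : right_distributive mps_scale +%R.
Proof. by move=> a f g; apply: mpsP => m /=; rewrite mulrDr. Qed.
Fact mps_scaleDl f : {morph mps_scale^~ f : a b / a + b}.
Proof. by move=> a b; apply: mpsP => m /=; rewrite mulrDl. Qed.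

HB.instance Definition _ := GRing.Zmodule_isLmodule.Build K R
  mps_scaleA mps_scale1 mps_scaleDr mps_scaleDl.

(* There are finitely many variables, so the N-th power of the maximal ideal  *)
(* consists of the series without terms of degree < N.                        *)
Definition max_pow (N : nat) : set R :=
  [set f | forall m, (mdeg m < N)%N -> coefs f m = 0].

Definition derivation (v : R -> R) : Prop :=
  (forall (a : K) f g, v (a *: f + g) = a *: v f + v g) /\
  (forall f g, v (f * g) = v f * g + f * v g).

End PowerSeriesRing.

(* A multilinear map sending e_(i_1) (x) ... (x) e_(i_k) to                   *)
(* \sum_s phi [:: i_1; ...; i_k] s e_s, for all k >= 0 at once.               *)
Definition cochain (R : Type) (I : Type) := seq I -> I -> R.

Record ainf (R : comNzRingType) (I : finType) := AInf {
  unit_elt : I;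
  spar : I -> bool;                (* parity in the SHIFTED grading *)
  mu : cochain R I;
  form : I -> I -> R;
  dual : I -> I -> R;              (* e^s = \sum_r dual s r e_r *)
  dualP : forall s s', \sum_r dual s r * form s' r = (s' == s)%:R
}.

(* Koszul sign exponent: s lists, in their final order, the permuted factors  *)
(* as pairs (rank in the initial order, parity).                              *)
Fixpoint koszul (s : seq (nat * bool)) : bool :=
  if s is x :: s' then
    (x.2 && odd (count (fun y => y.2 && (y.1 < x.1)%N) s')) (+) koszul s'
  else false.

(* the factors a_(p+1), ..., a_q of w = [:: a_1; ...; a_k] *)
Definition slice (T : Type) (p q : nat) (w : seq T) := drop p (take q w).

Section Hochschild.
Variables (R : comNzRingType) (I : finType) (A : ainf R I).

Local Notation par w := (\big[addb/false]_(a <- w) spar A a).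
Local Notation one := (unit_elt A).

(* (a_0, [:: a_1; ...; a_k]) stands for a_0 | a_1 | ... | a_k *)
Definition word : choiceType := (I * seq I)%type.
Definition reduced (x : word) : bool := one \notin x.2.

(* The operators are given by their matrices: opE x y is the coefficient of   *)
(* the word y in the image of the word x.                                     *)
Definition bE (x y : word) : R :=
  let: (a0, w) := x in let k := size w in
    \sum_(q < k.+1) \sum_(p < k.+1 | (p <= q)%N) \sum_s
      (-1) ^+ par (a0 :: take p w) * mu A (slice p q w) s *
      (y == (a0, take p w ++ s :: drop q w))%:R
  + \sum_(p < k.+1) \sum_(j < k.+1 | (j <= p)%N) \sum_s
      (-1) ^+ koszul [:: (1, par (drop p w)); (0, par (a0 :: take p w))]%N *
      mu A (drop p w ++ a0 :: take j w) s *
      (y == (s, slice j p w))%:R.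

Definition BE (x y : word) : R :=
  let: (a0, w) := x in let k := size w in
  \sum_(p < k.+1)
    (-1) ^+ koszul [:: (1, par (drop p w)); (0, par (a0 :: take p w))]%N *
    (y == (one, drop p w ++ a0 :: take p w))%:R.

(* b^{1|1}(phi; -) and B^{1|1}(phi; -) for phi odd in the shifted grading, as *)
(* are v(mu) and kappa; initial order mu (resp. 1), phi, a_0, ..., a_k.       *)
Definition b11E (phi : cochain R I) (x y : word) : R :=
  let: (a0, w) := x in let k := size w in
  \sum_(r < k.+1) \sum_(q < k.+1 | (q <= r)%N)
  \sum_(p < k.+1 | (p <= q)%N) \sum_(j < k.+1 | (j <= p)%N) \sum_s \sum_s'
    (-1) ^+ koszul [:: (0, true); (3, par (slice p q w)); (1, true);
                       (4, par (drop q w)); (2, par (a0 :: take p w))]%N *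
    phi (slice q r w) s *
    mu A (slice p q w ++ s :: drop r w ++ a0 :: take j w) s' *
    (y == (s', slice j p w))%:R.

Definition B11E (phi : cochain R I) (x y : word) : R :=
  let: (a0, w) := x in let k := size w in
  \sum_(r < k.+1) \sum_(q < k.+1 | (q <= r)%N) \sum_(p < k.+1 | (p <= q)%N)
  \sum_s
    (-1) ^+ koszul [:: (0, true); (3, par (slice p q w)); (1, true);
                       (4, par (drop q w)); (2, par (a0 :: take p w))]%N *
    phi (slice q r w) s *
    (y == (one, slice p q w ++ s :: drop r w ++ a0 :: take p w))%:R.

(* cyc [:: a_1; ...; a_k] a_(k+1) = <mu_k(a_1, ..., a_k), a_(k+1)> *)
Definition cyc (w : seq I) (a : I) : R := \sum_s mu A w s * form A s a.

(* initial order e_s, e^s, e_t, e^t, a_0, ..., a_i, b_0, ..., b_j *)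
Definition mukE (x y : word) : R :=
  let: (a0, a) := x in let: (b0, b) := y in
  \sum_(q < (size a).+1) \sum_(p < (size a).+1 | (p <= q)%N)
  \sum_(q' < (size b).+1) \sum_(p' < (size b).+1 | (p' <= q')%N)
  \sum_s \sum_t \sum_s' \sum_t'
    (-1) ^+ koszul [:: (6, par (drop q a)); (4, par (a0 :: take p a));
                       (0, spar A s); (8, par (slice p' q' b)); (2, spar A t);
                       (9, par (drop q' b)); (7, par (b0 :: take p' b));
                       (1, spar A s'); (5, par (slice p q a));
                       (3, spar A t')]%N *
    dual A s s' * dual A t t' *
    cyc (drop q a ++ a0 :: take p a ++ s :: slice p' q' b) t *
    cyc (drop q' b ++ b0 :: take p' b ++ s' :: slice p q a) t'.

(* Chains are families of coefficients indexed by words. \sum_(x \in D) is a  *)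
(* finitely supported sum: for the algebras below mu_k = 0 for k large, so    *)
(* that a given word y only receives contributions from finitely many x, even *)
(* when z is a completed chain.                                               *)
Definition chain := word -> R.

Definition apply (op : word -> word -> R) (z : chain) : chain :=
  fun y => if reduced y then \sum_(x \in [set x | reduced x]) z x * op x y
           else 0.

Definition mukai (z w : chain) : R :=
  \sum_(x \in [set x : word * word | reduced x.1 /\ reduced x.2])
    z x.1 * w x.2 * mukE x.1 x.2.

Definition Gamma (z : chain) : chain := fun y => - ((size y.2)%:R * z y).

(* z l is the coefficient of u^l *)
Definition uchain := int -> chain.

Definition umul (z : uchain) : uchain := fun l => z (l - 1).

Definition bB (z : uchain) : uchain :=
  fun l y => apply bE (z l) y + apply BE (z (l - 1)) y.

(* coefficient of u^l in <z, w>_hres, for z and w without negative powers     *)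
Definition hres (z w : uchain) (l : nat) : R :=
  \sum_(i < l.+1) (-1) ^+ i * mukai (z i%:Z) (w (l - i)%N%:Z).

Section Homology.
(* CC is the module of reduced (completed) chains *)
Variable CC : set chain.

Definition HH_cycle (c : chain) := CC c /\ apply bE c = 0.
Definition HH_homologous (c c' : chain) :=
  exists2 eta, CC eta & c - c' = apply bE eta.

Definition CCpow : set uchain :=
  [set z | (forall l, CC (z l)) /\ (forall l : int, (l < 0)%R -> z l = 0)].

Definition HCm_cycle (z : uchain) := CCpow z /\ bB z = 0.
Definition HCm_homologous (z w : uchain) :=
  exists2 eta, CCpow eta & z - w = bB eta.

(* an element of HC^-_*: a homology class, as the set of its representatives *)
Record HCminus := HCMinus {
  reps :> set uchain;
  repsP : exists2 z, HCm_cycle z &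
            reps = [set w | HCm_cycle w /\ HCm_homologous w z]
}.

End Homology.

(* [phi] = [phi'] in HH^*, computed by the reduced cochains (those on inputs  *)
(* in A/1, which are all that act on reduced chains): mu represents a class   *)
(* through its restriction to such inputs. (On unreduced cochains, the        *)
(* coboundary [mu, id] = \sum_k (k - 1) mu_k makes the class of mu twice this *)
(* one for the algebras below.) hdelta psi = [mu, psi].                       *)
Definition cochain_reduced (psi : cochain R I) :=
  forall w s, one \in w -> psi w s = 0.

Definition hdelta (psi : cochain R I) : cochain R I := fun w s =>
  \sum_(q < (size w).+1) \sum_(p < (size w).+1 | (p <= q)%N) \sum_r
    let w' := take p w ++ r :: drop q w in
    (-1) ^+ ((par (slice p q w) (+) spar A r) && par (take p w)) *
      psi (slice p q w) r * mu A w' s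
    - (-1) ^+ ((par w' (+) spar A s) (+) par (take p w)) *
      mu A (slice p q w) r * psi w' s.

Definition cohomologous (phi phi' : cochain R I) :=
  exists2 psi, cochain_reduced psi &
    forall w s, one \notin w -> phi w s - phi' w s = hdelta psi w s.

End Hochschild.

Definition finite_chains (R : comNzRingType) (I : finType) (A : ainf R I) :
    set (chain R I) :=
  [set z | (forall x, ~~ reduced A x -> z x = 0) /\
           finite_set [set x | z x != 0]].

Section Families.
Variables (K : fieldType) (n : nat) (I : finType).
Local Notation R := (mps n K).
(* A0 is the central fiber of A *)
Variables (A0 : ainf K I) (A : ainf R I).

(* An element of the inverse limit over N of CC_* modulo the N-th power of the *)
(* ideal is a family that is finitely supported modulo each such power.       *)
Definition adic_chains : set (chain R I) :=
  [set z | (forall x, ~~ reduced A x -> z x = 0) /\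
           forall N, finite_set [set x | ~ max_pow N (z x)]].

(* likewise for CC((u)): Laurent series in u modulo each power of the ideal *)
Definition adic_laurent : set (uchain R I) :=
  [set z | (forall l, adic_chains (z l)) /\
           forall N, exists l0 : int, forall l x, (l < l0)%R ->
             max_pow N (z l x)].

Definition HP_homologous (z w : uchain R I) :=
  exists2 eta, adic_laurent eta & z - w = bB A eta.

Definition deriv_mu (v : R -> R) : cochain R I := fun w s => v (mu A w s).

Definition kappa : cochain R I := fun w s => (2 - (size w)%:R) * mu A w s.

Definition nabla (v : R -> R) (z : uchain R I) : uchain R I := fun l y =>
  v (z l y) - apply A (b11E A (deriv_mu v)) (z (l + 1)) y
            - apply A (B11E A (deriv_mu v)) (z l) y.

Definition nabla_du (z : uchain R I) : uchain R I := fun l y =>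
  (l + 1)%:~R * z (l + 1) y +
  (2 : K)^-1 *: (Gamma (z (l + 1)) y
                 + apply A (B11E A kappa) (z (l + 1)) y
                 + apply A (b11E A kappa) (z (l + 2)) y).

Definition unabla (v : R -> R) (z : uchain R I) := umul (nabla v z).
Definition unabla_du (z : uchain R I) := umul (nabla_du z).

Definition central_fiber (z : uchain R I) : uchain K I :=
  fun l x => coefs (z l x) 0%MM.

Section Conditions.
Variables (omega : uchain K I) (z : uchain R I).

Definition P0 := HCm_homologous A0 (finite_chains A0) (central_fiber z) omega.

(* v |-> [pi (unabla v z)] is R-linear (modulo u it only involves             *)
(* b^{1|1}(v(mu); -)), so it is an isomorphism as soon as it is bijective.    *)
Definition P1 := forall c, HH_cycle A adic_chains c ->
  exists! v, derivation v /\ HH_homologous A adic_chains (unabla v z 0) c.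

Definition P2 := forall v1 v2, derivation v1 -> derivation v2 ->
  forall l, (1 <= l)%N -> hres A (unabla v1 z) (unabla v2 z) l = 0.

Definition P3 := forall v1 v2 v3,
  derivation v1 -> derivation v2 -> derivation v3 ->
  forall l, (2 <= l)%N ->
    hres A (unabla v1 (unabla v2 z)) (unabla v3 z) l = 0.

Definition P4 := exists E, [/\ derivation E,
  cohomologous A (deriv_mu E) (mu A) &
  exists r : K, HP_homologous (unabla_du z + nabla E z)
                              (fun l y => r *: z l y)].

End Conditions.

Definition categorical_primitive_form (omega : uchain K I)
    (zeta : HCminus A adic_chains) :=
  forall z, reps zeta z -> [/\ P0 omega z, P1 z, P2 z, P3 z & P4 z].

End Families.

Inductive gen := e1 | eps.

Definition is_eps (s : gen) : bool := if s is eps then true else false.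
Definition gen_of_bool (b : bool) : gen := if b then eps else e1.
Fact is_epsK : cancel is_eps gen_of_bool. Proof. by case. Qed.

HB.instance Definition _ := Finite.copy gen (can_type is_epsK).

(* strict unit, and mu_k(eps, ..., eps) = t k 1 *)
Definition eps_mu (R : comNzRingType) (t : nat -> R) : cochain R gen :=
  fun w s => match w with
  | [:: e1; a] => (s == a)%:R
  | [:: eps; e1] => - (s == eps)%:R
  | _ => if (e1 \notin w) && (s == e1) then t (size w) else 0
  end.

(* <1, eps> = 1; cyclicity of <mu_2(-, -), -> in shifted signs then forces    *)
(* <eps, 1> = -1.                                                             *)
Definition eps_form (R : comNzRingType) (s s' : gen) : R :=
  match s, s' with
  | e1, eps => 1
  | eps, e1 => -1
  | _, _ => 0
  end.

Fact eps_dualP (R : comNzRingType) (s s' : gen) :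
  \sum_r eps_form R s r * eps_form R s' r = (s' == s)%:R.
Proof.
rewrite (bigD1 e1) // (bigD1 eps) //= big1; last by case.
by case: s s' => -[] /=; rewrite ?(mul0r, mulr0, addr0, add0r, mulrNN, mul1r).
Qed.

Definition eps_ainf (R : comNzRingType) (t : nat -> R) : ainf R gen :=
  AInf e1 (fun s => ~~ is_eps s) (eps_mu t) (@eps_dualP R).

Section VersalDeformation.
Variables (K : fieldType) (n : nat).

Definition An : ainf K gen :=
  eps_ainf (fun k => if k == n.+1 then n.+1%:R^-1 else 0).

Definition An_versal : ainf (mps n K) gen :=
  eps_ainf (fun k => if k == n.+1 then mps_const n (n.+1%:R^-1)
                     else if insub k is Some i then mps_var K i else 0).

Definition omega_coef (l : nat) : K :=
  \prod_(j < l) (n + j * n.+1)%N%:R.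

Definition omega : uchain K gen := fun l x =>
  if l is Posz l then
    (-1) ^+ l * omega_coef l * (x == (eps, nseq (n.-1 + n * l + l) eps))%:R
  else 0.

End VersalDeformation.

(* Main.v *)
Require Import Defs.
From mathcomp Require Import all_boot all_order all_algebra.
From mathcomp Require Import mpoly.
From mathcomp Require Import boolp classical_sets functions cardinality fsbigop.
From mathcomp Require Import zify ring.

(** Let W(x) be the sum of the t_k x^k, k < n, and of x^(n+1)/(n+1): the
structure constants of the deformed algebra are the coefficients of W. A
reduced chain has an eps-part and a 1-part, each a sequence of power series in
t indexed by the number k of letters eps after the bar. Read eps^k as x^(-k-1)
modulo polynomials in x: dropping a letter is multiplication by x, and b + uB
becomes the map W'(x) - u d/dx from the eps-part to the 1-part. As W' is monic
of degree n, prescribing the coefficients with k < n of the eps-part makes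
this map invertible, by recursion on k ([twisted_solve], [twisted_inj]); its
lower coefficients lie in the maximal ideal, so the recursion preserves adic
completeness ([twisted_laurent]). Hence every 1-part is a boundary
([bB_surj]), and a class of HC^- amounts to an eps-part in the kernel, itself
determined by its coefficients with k < n.

The primitive form is zeta = (W' - u d/dx)^(-1) (1), expanded in powers of
1/x; in terms of the recursion, it is the cycle whose coefficients with k < n
vanish except for that of eps|eps^(n-1) u^0, which is 1 ([zcoef]).
- P0: modulo t the recursion is the one defining omega ([zcoef_central]).
- P1: modulo u the operator u nabla_v is multiplication by -v(W), and v(W)
  ranges over the polynomials of degree < n. The matrix of the coefficients of
  x^(-k-1) in x^i zeta, for i, k < n, is unitriangular up to the order of its
  columns ([hankel]).
- P2, P3: parity and arity of the structure maps make the Mukai pairing vanish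
  except between eps|eps^i and eps|eps^j with i + j < n ([mukE_supp]). But the
  coefficient of u^l in zeta starts at k = n - 1 + (n + 1) l ([zcoef_supp]),
  too far for the at most two multiplications by v(W) to bring it back below n
  ([rep_unabla_init], [rep_unabla2_init]).
- P4: W is quasi-homogeneous if t_i has weight (n + 1 - i)/(n + 1) and x has
  weight 1/(n + 1), so zeta is too ([zcoef_euler]), and the sum of the
  u-connection and of the connection along the Euler field acts on cycles as a
  grading operator ([euler_connection]).

Uniqueness follows from P0 and P4. Division by the Weierstrass polynomial W'
shows that E is the Euler field ([cohomologous_unique]). Then P4 says that the
coefficient of eps|eps^k u^l has weight (k + 1 - n)/(n + 1) - l; for k < n
this is negative, or zero when l = 0 and k = n - 1, so that these coefficients
are constants, given by the central fiber ([primitive_epart]). *)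

Set Implicit Arguments.
Unset Strict Implicit.
Unset Printing Implicit Defensive.

Import Order.TTheory GRing.Theory Num.Theory.

Local Open Scope ring_scope.

#[local] Arguments eps_mu : simpl never.

(** * Power series, powers of the maximal ideal and derivations *)

Section PowerSeries.
Variables (n : nat) (K : fieldType).
Local Notation R := (mps n K).
Implicit Types (f g : R) (m : 'X_{1..n}) (i j : 'I_n).

Lemma coefs0 m : coefs (0 : R) m = 0.
Proof. by rewrite /= if_same. Qed.

Lemma coefsD f g m : coefs (f + g) m = coefs f m + coefs g m.
Proof. by []. Qed.

Lemma coefsN f m : coefs (- f) m = - coefs f m.
Proof. by []. Qed.

Lemma coefsB f g m : coefs (f - g) m = coefs f m - coefs g m.
Proof. by []. Qed.

Lemma coefsZ (a : K) f m : coefs (a *: f) m = a * coefs f m.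
Proof. by []. Qed.

Lemma coefs1 m : coefs (1 : R) m = (m == 0%MM)%:R.
Proof. by rewrite /=; case: ifP. Qed.

Lemma coefs_sum (I : Type) (r : seq I) (P : pred I) (F : I -> R) m :
  coefs (\sum_(i <- r | P i) F i) m = \sum_(i <- r | P i) coefs (F i) m.
Proof.
exact: (big_morph (fun f => coefs f m) (fun f g => coefsD f g m) (coefs0 m)).
Qed.

Lemma coefsMn f k m : coefs (f *+ k) m = coefs f m *+ k.
Proof. by elim: k => [|k IH]; rewrite ?mulr0n ?coefs0 // !mulrS coefsD IH. Qed.

Lemma coefsM0 f g : coefs (f * g) 0%MM = coefs f 0%MM * coefs g 0%MM.
Proof.
rewrite (@coefs_mul _ _ 1) ?mdeg0 // -[_@_ _]/(mcoeff 0%MM _) rmorphM /=.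
by rewrite !mcoeff_trunc mdeg0.
Qed.

Lemma mps_const_scale (a : K) : mps_const n a = a *: (1 : R).
Proof. by apply: mpsP => m /=; case: eqP; rewrite ?mulr1 ?mulr0. Qed.

Lemma mps_scaleAl (a : K) f g : a *: (f * g) = (a *: f) * g.
Proof.
apply: mpsP => m /=; rewrite mulr_sumr; apply: eq_bigr => k _.
by rewrite mulrA.
Qed.

Lemma mps_scaleAr (a : K) f g : a *: (f * g) = f * (a *: g).
Proof. by rewrite mulrC mps_scaleAl mulrC. Qed.

Lemma mps_natZ k f : k%:R * f = (k%:R : K) *: f.
Proof. by rewrite mulr_natl scaler_nat. Qed.

Lemma coefs_varM i f m :
  coefs (mps_var K i * f) m =
  if (0 < m i)%N then coefs f (m - U_(i))%MM else 0.
Proof.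
case: ifPn => mi.
  rewrite (@coefs_mul _ _ (mdeg m).+2) //.
  have -> : mps_trunc (mdeg m).+2 (mps_var K i) = 'X_i.
    apply/mpolyP => k; rewrite mcoeff_trunc mcoeffX /= eq_sym.
    by case: eqP => [<-|]; rewrite ?mdeg1 ?if_same.
  have Um : (U_(i) <= m)%MM by rewrite lep1mP -lt0n.
  rewrite mulrC -{1}(submK Um) addmC mcoeffMX mcoeff_trunc.
  by rewrite ifT // -{2}(submK Um) mdegD; lia.
rewrite /= big1 // => -[k1 k2] /= /eqP mE; case: eqP => [kU|_]; last first.
  by rewrite mul0r.
by case/negP: mi; move/mnmP/(_ i): mE => ->; rewrite mnmDE kU mnm1E eqxx.
Qed.

Lemma var_lreg i f : mps_var K i * f = 0 -> f = 0.
Proof.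
move=> if0; apply: mpsP => m; rewrite coefs0.
have := congr1 (fun g => coefs g (m + U_(i))%MM) if0.
by rewrite coefs_varM mnmDE mnm1E eqxx addn1 addmK coefs0.
Qed.

Lemma max_pow_zero N : max_pow N (0 : R).
Proof. by move=> m _; rewrite coefs0. Qed.

Lemma max_powD N f g : max_pow N f -> max_pow N g -> max_pow N (f + g).
Proof. by move=> fN gN m mN; rewrite coefsD fN ?gN ?addr0. Qed.

Lemma max_powN N f : max_pow N f -> max_pow N (- f).
Proof. by move=> fN m mN; rewrite coefsN fN ?oppr0. Qed.

Lemma max_powB N f g : max_pow N f -> max_pow N g -> max_pow N (f - g).
Proof. by move=> fN gN; apply: max_powD => //; apply: max_powN. Qed.

Lemma max_pow_sum N (I : Type) (r : seq I) (P : pred I) (F : I -> R) :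
  (forall x, P x -> max_pow N (F x)) -> max_pow N (\sum_(i <- r | P i) F i).
Proof.
move=> FN; apply: (big_ind (@max_pow n K N)) => //.
  exact: max_pow_zero.
by move=> f g; apply: max_powD.
Qed.

Lemma max_powM a b f g : max_pow a f -> max_pow b g -> max_pow (a + b) (f * g).
Proof.
move=> fa gb m mab; rewrite /= big1 // => -[k1 k2] /= /eqP mE.
have [k1a|ak1] := ltnP (mdeg k1) a; first by rewrite fa // mul0r.
rewrite gb ?mulr0 //; have := congr1 mdeg mE; rewrite mdegD; lia.
Qed.

Lemma max_powMl N f g : max_pow N g -> max_pow N (f * g).
Proof. exact: (@max_powM 0 N). Qed.

Lemma max_powZ N (a : K) f : max_pow N f -> max_pow N (a *: f).
Proof. by move=> fN m mN; rewrite coefsZ fN ?mulr0. Qed.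

Lemma max_pow_var i : max_pow 1 (mps_var K i).
Proof.
move=> m; rewrite ltnS leqn0 mdeg_eq0 => /eqP->.
by rewrite /= eq_sym -mdeg_eq0 mdeg1.
Qed.

Lemma max_pow_inf f : (forall N, max_pow N f) -> f = 0.
Proof. by move=> fN; apply: mpsP => m; rewrite coefs0 (fN (mdeg m).+1). Qed.

Section Derivation.
Variables (v : R -> R) (dv : derivation v).

Lemma derivationD f g : v (f + g) = v f + v g.
Proof. by have := dv.1 1 f g; rewrite !scale1r. Qed.

Lemma derivation0 : v 0 = 0.
Proof. by apply: (addrI (v 0)); rewrite -derivationD !addr0. Qed.

Lemma derivationZ (a : K) f : v (a *: f) = a *: v f.
Proof. by have := dv.1 a f 0; rewrite derivation0 !addr0. Qed.

Lemma derivationN f : v (- f) = - v f.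
Proof. by rewrite -[- f]scaleN1r derivationZ scaleN1r. Qed.

Lemma derivationM f g : v (f * g) = v f * g + f * v g.
Proof. exact: dv.2. Qed.

Lemma derivation1 : v 1 = 0.
Proof.
by apply: (addrI (v 1)); rewrite -{3}[1](mulr1 1) derivationM mulr1 mul1r addr0.
Qed.

Lemma derivation_const (a : K) : v (mps_const n a) = 0.
Proof. by rewrite mps_const_scale derivationZ derivation1 scaler0. Qed.

Lemma derivation_sum (I : Type) (r : seq I) (P : pred I) (F : I -> R) :
  v (\sum_(i <- r | P i) F i) = \sum_(i <- r | P i) v (F i).
Proof. exact: (big_morph v derivationD derivation0). Qed.

End Derivation.

Definition diag_op (w : 'X_{1..n} -> K) f : R := MPS (fun m => w m * coefs f m).

Lemma diag_derivation (w : 'X_{1..n} -> K) :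
  (forall m m', w (m + m')%MM = w m + w m') -> derivation (diag_op w).
Proof.
move=> wD; split=> [a f g|f g]; apply: mpsP => m /=.
  by rewrite mulrDr mulrCA.
rewrite mulr_sumr -big_split /=; apply: eq_bigr => k /eqP mE.
have -> : w m = w k.1 + w k.2 by rewrite -wD -mE.
by rewrite mulrDl mulrA; congr (_ + _); rewrite mulrCA.
Qed.

Definition partial i f : R :=
  MPS (fun m => (m i).+1%:R * coefs f (m + U_(i))%MM).

Lemma var_partial i f :
  mps_var K i * partial i f = diag_op (fun m => (m i)%:R) f.
Proof.
apply: mpsP => m; rewrite coefs_varM /=; case: ifPn => mi.
  by rewrite submK ?lep1mP -?lt0n // mnmBE mnm1E eqxx subn1 prednK.
by move: mi; rewrite -eqn0Ngt => /eqP->; rewrite mul0r.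
Qed.

(** The Leibniz rule is clear for t_i d/dt_i, which acts diagonally on the
monomials; it descends to d/dt_i because t_i is not a zero divisor. *)
Lemma partial_derivation i : derivation (partial i).
Proof.
split=> [a f g|f g].
  by apply: mpsP => m /=; rewrite mulrDr mulrCA.
apply/eqP; rewrite -subr_eq0; apply/eqP/(@var_lreg i).
rewrite mulrBr var_partial derivationM; last first.
  by apply: diag_derivation => m m'; rewrite mnmDE natrD.
rewrite -!var_partial.
by move: (mps_var K i) (partial i f) (partial i g) => t a b; ring.
Qed.

Lemma partial_var i j : partial i (mps_var K j) = (i == j)%:R.
Proof.
apply: mpsP => m; rewrite -[RHS]/(coefs ((i == j)%:R : R) m).
have -> : coefs ((i == j)%:R : R) m = (m == 0%MM)%:R * (i == j)%:R.
  by case: eqP; rewrite ?coefs0 ?coefs1 ?mulr1 ?mulr0.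
rewrite /=; case: (eqVneq i j) => [<-|ij].
  rewrite mulr1 -{2}[U_(i)%MM]add0m (can_eq (addmK _)).
  by case: eqP => [->|_]; rewrite ?mulr0 // mnm0E mulr1.
rewrite mulr0; case: eqP => [|_]; last by rewrite mulr0.
move/mnmP/(_ i); rewrite mnmDE !mnm1E eqxx eq_sym (negbTE ij); lia.
Qed.

Lemma vector_field_derivation (a : 'I_n -> R) :
  derivation (fun f => \sum_i a i * partial i f).
Proof.
split=> [c f g|f g].
  rewrite scaler_sumr -big_split /=; apply: eq_bigr => i _.
  rewrite (partial_derivation i).1 mulrDr; congr (_ + _).
  by rewrite mulrC -mps_scaleAl mulrC.
rewrite mulr_suml mulr_sumr -big_split /=; apply: eq_bigr => i _.
by rewrite (derivationM (partial_derivation i)) mulrDr mulrA mulrCA.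
Qed.

Lemma vector_field_var (a : 'I_n -> R) j :
  \sum_i a i * partial i (mps_var K j) = a j.
Proof.
rewrite (bigD1 j) //= partial_var eqxx mulr1 big1 ?addr0 // => i ij.
by rewrite partial_var (negbTE ij) mulr0.
Qed.

Hypothesis charK : [pchar K] =i pred0.

Lemma natS_neq0 k : (k.+1%:R : K) != 0.
Proof. by rewrite ((pcharf0P K).1 charK). Qed.

(** Euler's identity: a monomial of degree d > 0 is the sum of its t_i d/dt_i
divided by d. *)
Lemma hadamard f : exists g : 'I_n -> R,
  f = mps_const n (coefs f 0%MM) + \sum_i mps_var K i * g i.
Proof.
exists (fun i => MPS (fun m =>
  (m i).+1%:R / (mdeg m).+1%:R * coefs f (m + U_(i))%MM)).
apply: mpsP => m; rewrite coefsD coefs_sum [coefs (mps_const _ _) m]/=.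
rewrite (eq_bigr (fun i => (m i)%:R / (mdeg m)%:R * coefs f m)); last first.
  move=> i _; rewrite coefs_varM /=; case: ifPn => mi; last first.
    by move: mi; rewrite -eqn0Ngt => /eqP->; rewrite !mul0r.
  have Um : (U_(i) <= m)%MM by rewrite lep1mP -lt0n.
  rewrite submK // mnmBE mnm1E eqxx subn1 prednK //; congr (_ / _%:R * _).
  by rewrite -{2}(submK Um) mdegD mdeg1 addn1.
case: eqP => [->|/eqP m0].
  by rewrite big1 ?addr0 // => i _; rewrite mnm0E !mul0r.
rewrite add0r -mulr_suml -mulr_suml -natr_sum -mdegE divff ?mul1r //.
by rewrite -mdeg_eq0 in m0; case: (mdeg m) m0 => // k _; apply: natS_neq0.
Qed.

(** No continuity is assumed: writing f = f(0) + sum_i t_i g_i, the difference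
of the two derivations on f is a combination of the t_i with coefficients its
values on the g_i, so it lies one power of the maximal ideal higher than what
is known for all series. *)
Lemma derivation_ext (v v' : R -> R) : derivation v -> derivation v' ->
  (forall i, v (mps_var K i) = v' (mps_var K i)) -> v =1 v'.
Proof.
move=> dv dv' vv' f; apply/eqP; rewrite -subr_eq0; apply/eqP/max_pow_inf => N.
elim: N f => [|N IH] f //.
have [g ->] := hadamard f.
rewrite (derivationD dv) (derivationD dv') (derivation_const dv).
rewrite (derivation_const dv') !add0r (derivation_sum dv) (derivation_sum dv').
rewrite -sumrB; apply: max_pow_sum => i _.
rewrite (derivationM dv) (derivationM dv') vv' opprD addrACA subrr add0r.
rewrite -mulrBr -add1n.
by apply: max_powM (max_pow_var i) (IH _).
Qed.

Lemma derivation_max_pow (v : R -> R) N f : derivation v ->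
  max_pow N.+1 f -> max_pow N (v f).
Proof.
move=> dv fN.
rewrite (derivation_ext dv (vector_field_derivation (v \o mps_var K))).
  apply: max_pow_sum => i _; apply: max_powMl => m mN /=.
  by rewrite fN ?mulr0 // mdegD mdeg1 addn1.
by move=> i; rewrite vector_field_var.
Qed.

End PowerSeries.

(** * Matrix entries of the operators on reduced words *)

Lemma sum_only1 (V : nmodType) (I : finType) (i0 : I) (P : pred I) (F : I -> V) :
  P i0 -> (forall i, P i -> i != i0 -> F i = 0) -> \sum_(i | P i) F i = F i0.
Proof.
move=> Pi0 F0; rewrite (bigD1 i0) //= big1 ?addr0 // => i /andP[Pi ii0].
exact: F0.
Qed.

Lemma sum_gen (V : nmodType) (F : gen -> V) : \sum_s F s = F e1 + F eps.
Proof. by rewrite (bigD1 e1) //= (bigD1 eps) //= big1 ?addr0 //; case. Qed.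

(** A block of i letters sits at k + 1 - i positions in a word of k letters; this
multiplicity turns the potential into its derivative, in [b] as well as in the
Hochschild coboundary. *)
Lemma sum_sub_le (V : nmodType) k (F : nat -> V) :
  \sum_(q < k.+1) \sum_(p < k.+1 | (p <= q)%N) F (q - p)%N =
  \sum_(i < k.+1) F i *+ (k - i).+1.
Proof.
transitivity (\sum_(q < k.+1) \sum_(i < q.+1) F i).
  apply: eq_bigr => q _.
  rewrite [RHS](reindex_inj rev_ord_inj) /=.
  by rewrite (big_ord_widen k.+1 (fun i => F (q.+1 - i.+1)%N)).
elim: k => [|k IH]; first by rewrite !big_ord1.
rewrite big_ord_recr /= IH [in RHS]big_ord_recr /= subnn mulr1n.
rewrite [X in _ + X = _]big_ord_recr /= addrA -big_split /=; congr (_ + _).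
by apply: eq_bigr => i _; rewrite -mulrSr subSn // -ltnS.
Qed.

Section EpsAlgebra.
Variables (R : comNzRingType) (T : nat -> R).
Local Notation A := (eps_ainf T).
Implicit Types (z : chain R gen) (y : word gen).

(** These are all the reduced words. *)
Definition epsw k : word gen := (eps, nseq k eps).
Definition onew k : word gen := (e1, nseq k eps).

Lemma e1_notin_nseq k : e1 \notin nseq k eps.
Proof. by apply/negP => /nseqP[]. Qed.

Lemma e1_notinP (w : seq gen) : e1 \notin w -> w = nseq (size w) eps.
Proof.
elim: w => //= a w IH; rewrite inE negb_or => /andP[a1 /IH <-].
by case: a a1.
Qed.

Lemma reduced_epsw k : reduced A (epsw k).
Proof. exact: e1_notin_nseq. Qed.

Lemma reduced_onew k : reduced A (onew k).
Proof. exact: e1_notin_nseq. Qed.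

Lemma reducedP y : reduced A y ->
  y = epsw (size y.2) \/ y = onew (size y.2).
Proof.
by case: y => [a w] yr; have /= {1 3}-> := e1_notinP yr; case: a {yr}; [right|left].
Qed.

Lemma epsw_inj : injective epsw.
Proof. by move=> k m [] /(congr1 size); rewrite !size_nseq. Qed.

Lemma onew_inj : injective onew.
Proof. by move=> k m [] /(congr1 size); rewrite !size_nseq. Qed.

Lemma par_nseq k : \big[addb/false]_(a <- nseq k eps) spar A a = false.
Proof. by elim: k => [|k IH]; rewrite ?big_nil // big_cons IH. Qed.

Lemma par_cons a k :
  \big[addb/false]_(b <- a :: nseq k eps) spar A b = ~~ is_eps a.
Proof. by rewrite big_cons par_nseq addbF. Qed.

Lemma drop_nseq (X : Type) (x : X) p k : drop p (nseq k x) = nseq (k - p) x.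
Proof. by elim: k p => [|k IH] [|p] //=. Qed.

Lemma take_nseq_min (X : Type) (x : X) p k :
  take p (nseq k x) = nseq (minn p k) x.
Proof. by elim: k p => [|k IH] [|p] //=; rewrite IH minnSS. Qed.

Lemma take_nseq_le (X : Type) (x : X) p k : (p <= k)%N ->
  take p (nseq k x) = nseq p x.
Proof. by move=> pk; rewrite take_nseq_min (minn_idPl pk). Qed.

Lemma slice_nseq (X : Type) (x : X) p q k : (q <= k)%N ->
  slice p q (nseq k x) = nseq (q - p) x.
Proof. by move=> qk; rewrite /slice take_nseq_le // drop_nseq. Qed.

Lemma eps_mu_nseq k s : eps_mu T (nseq k eps) s = if s is e1 then T k else 0.
Proof.
have -> : eps_mu T (nseq k eps) s =
    if (e1 \notin nseq k eps) && (s == e1) then T (size (nseq k eps)) else 0.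
  by case: k => [|[|[|k]]].
by rewrite e1_notin_nseq size_nseq; case: s.
Qed.

Lemma eps_mu_e1 (w : seq gen) s : e1 \in w -> size w != 2%N -> eps_mu T w s = 0.
Proof.
by move=> ew; rewrite /eps_mu ew; case: w ew => [|[] [|[] [|c w]]].
Qed.

Lemma apply_nonreduced op z y : ~~ reduced A y -> apply A op z y = 0.
Proof. by rewrite /apply => /negbTE ->. Qed.

(** A column of [op] with finitely many entries makes the finitely supported sum
of [apply] an ordinary one, whatever the support of the chain. *)
Lemma apply_sum N op z y : reduced A y ->
  (forall k, (N <= k)%N -> op (epsw k) y = 0) ->
  (forall k, (N <= k)%N -> op (onew k) y = 0) ->
  apply A op z y =
  \sum_(k < N) (z (epsw k) * op (epsw k) y + z (onew k) * op (onew k) y).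
Proof.
move=> yr opE opU; rewrite /apply yr.
pose r := map epsw (iota 0 N) ++ map onew (iota 0 N).
have rr x : x \in r -> reduced A x.
  rewrite mem_cat => /orP[] /mapP[k _ ->].
    exact: reduced_epsw.
  exact: reduced_onew.
rewrite (@fsbigE _ _ _ _ _ r); first last.
- move=> x /= /reducedP[] -> xr.
    rewrite opE ?mulr0 // leqNgt; apply: contra xr => kN.
    by rewrite mem_cat map_f // mem_iota.
  rewrite opU ?mulr0 // leqNgt; apply: contra xr => kN.
  by rewrite mem_cat [X in _ || X]map_f ?orbT // mem_iota.
- by move=> x /=; apply: rr.
- rewrite cat_uniq (map_inj_uniq epsw_inj) (map_inj_uniq onew_inj).
  rewrite !iota_uniq andbT /=.
  by apply/hasPn => x /mapP[k _ ->]; apply/mapP => -[].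
rewrite big_mkcond /= big_seq_cond.
under eq_bigr => x do [rewrite andbT => /rr xr; rewrite mem_set //].
rewrite -big_seq_cond big_cat !big_map /= -[N]subn0 -!/(index_iota 0 N).
by rewrite !big_mkord subn0 -big_split.
Qed.

Lemma bE_epsw k y : reduced A y ->
  bE A (epsw k) y = \sum_(p < k.+1) \sum_(j < k.+1 | (j <= p)%N)
     T (k - (p - j)).+1 * (y == onew (p - j))%:R.
Proof.
move=> yr; rewrite /bE /= size_nseq big1 ?add0r.
  apply: eq_bigr => p _; apply: eq_bigr => j jp.
  have pk : (p <= k)%N by rewrite -ltnS.
  rewrite sum_gen drop_nseq !take_nseq_le ?(leq_trans jp) // slice_nseq //.
  rewrite par_nseq par_cons /= !mul1r -[eps :: nseq j _]/(nseq j.+1 eps) -nseqD.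
  rewrite !eps_mu_nseq mul0r addr0.
  congr (T _ * _); lia.
move=> q _; rewrite big1 // => p _; rewrite sum_gen.
rewrite /slice !(take_nseq_min, drop_nseq) !eps_mu_nseq mulr0 mul0r addr0.
case: eqP => [yE|_]; last by rewrite mulr0.
by move: yr; rewrite yE /reduced /= mem_cat inE eqxx orbT.
Qed.

(** The coefficients of the derivative W' of the potential W(x) = sum_k T_k x^k. *)
Definition dpot i : R := i.+1%:R * T i.+1.

Lemma bE_epsw_onew k m :
  bE A (epsw k) (onew m) = if (m <= k)%N then dpot (k - m) else 0.
Proof.
rewrite bE_epsw ?reduced_onew //.
rewrite (sum_sub_le k (fun i => T (k - i).+1 * (onew m == onew i)%:R)).
have zero i : i != m -> T (k - i).+1 * (onew m == onew i)%:R = 0.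
  by move=> im; rewrite (inj_eq onew_inj) eq_sym (negbTE im) mulr0.
case: ifPn => [mk|km].
  rewrite (@sum_only1 _ _ (Ordinal (mk : (m < k.+1)%N))) //=.
    by rewrite eqxx mulr1 /dpot mulr_natl.
  by move=> i _ im; rewrite zero ?mul0rn.
rewrite big1 // => i _; rewrite zero ?mul0rn //.
by apply: contraNneq km => <-; rewrite -ltnS.
Qed.

Lemma bE_epsw_epsw k m : bE A (epsw k) (epsw m) = 0.
Proof.
rewrite bE_epsw ?reduced_epsw // big1 // => p _; rewrite big1 // => j _.
by rewrite mulr0.
Qed.

(** The unit of the 0-th slot can only be multiplied with the first or with the
last letter, and these two products have opposite signs. *)
Lemma bE_onew k y : reduced A y -> bE A (onew k) y = 0.
Proof.
move=> yr; rewrite /bE /= size_nseq big1 ?add0r; last first.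
  move=> q _; rewrite big1 // => p _; rewrite sum_gen.
  rewrite /slice !(take_nseq_min, drop_nseq) !eps_mu_nseq mulr0 mul0r addr0.
  case: eqP => [yE|_]; last by rewrite mulr0.
  by move: yr; rewrite yE /reduced /= mem_cat inE eqxx orbT.
have termE (p j : 'I_k.+1) : (j <= p)%N ->
   \sum_s (-1) ^+ koszul [::
       (1%N, \big[addb/false]_(a <- drop p (nseq k eps)) spar A a);
       (0%N, \big[addb/false]_(a <- e1 :: take p (nseq k eps)) spar A a)] *
     eps_mu T (drop p (nseq k eps) ++ e1 :: take j (nseq k eps)) s *
     (y == (s, slice j p (nseq k eps)))%:R =
   (((p == k :> nat) && (j == 1 :> nat))%:R -
    ((p.+1 == k :> nat) && (j == 0 :> nat))%:R) * (y == epsw k.-1)%:R :> R.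
  move=> jp; have pk : (p <= k)%N by rewrite -ltnS.
  rewrite drop_nseq !take_nseq_le ?(leq_trans jp) // slice_nseq // par_nseq par_cons /=.
  rewrite expr0; under eq_bigr => s _ do rewrite mul1r.
  case: (eqVneq (p : nat) k) => [pE|pk'] /=.
    rewrite pE subnn (_ : (k.+1 == k) = false) ?subr0; last by lia.
    case: eqP => [jE|j1] /=; last first.
      rewrite mul0r big1 // => s _.
      by rewrite eps_mu_e1 ?mul0r ?inE ?eqxx //= size_nseq; lia.
    by rewrite jE subn1 sum_gen /eps_mu /= mul0r add0r.
  rewrite sub0r; case: (eqVneq (p.+1 : nat) k) => [pE|pk''] /=.
    have -> : (k - p = 1)%N by lia.
    have -> : k.-1 = p by lia.
    case: eqP => [jE|j1] /=; last first.
      rewrite oppr0 mul0r big1 // => s _.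
      rewrite eps_mu_e1 ?mul0r ?inE ?eqxx ?orbT //= size_nseq; lia.
    by rewrite jE subn0 sum_gen /eps_mu /= oppr0 mul0r add0r.
  rewrite oppr0 mul0r big1 // => s _.
  rewrite eps_mu_e1 ?mul0r // ?mem_cat ?inE ?eqxx ?orbT //.
  by rewrite size_cat /= !size_nseq; lia.
under eq_bigr => p _ do under eq_bigr => j jp do rewrite termE //.
under eq_bigr => p _ do rewrite -mulr_suml sumrB.
rewrite -mulr_suml sumrB.
case: k {termE} => [|k].
  rewrite !big1 ?subrr ?mul0r // => p _; rewrite big1 // => j _.
  by rewrite (ord1 j) andbF.
rewrite [X in (X - _) * _](_ : _ = 1); last first.
  rewrite (@sum_only1 _ _ ord_max) //=; last first.
    move=> p _ pne; rewrite big1 // => j _.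
    rewrite (_ : (p == k.+1 :> nat) = false) //; apply/negP => /eqP pE.
    by case/eqP: pne; apply/val_inj.
  have k1 : (1 < k.+2)%N by [].
  rewrite (@sum_only1 _ _ (Ordinal k1)) //= ?eqxx //.
  move=> j _ jne; case: eqP => [jE|]; last by rewrite andbF.
  by case/eqP: jne; apply/val_inj.
rewrite [X in (_ - X) * _](_ : _ = 1) ?subrr ?mul0r //.
have kk : (k < k.+2)%N by [].
rewrite (@sum_only1 _ _ (Ordinal kk)) //=; last first.
  move=> p _ pne; rewrite big1 // => j _.
  rewrite (_ : (p.+1 == k.+1) = false) //; apply/negP => /eqP [pE].
  by case/eqP: pne; apply/val_inj.
rewrite (@sum_only1 _ _ ord0) //= ?eqxx //.
move=> j _ jne; case: eqP => [jE|]; last by rewrite andbF.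
by case/eqP: jne; apply/val_inj.
Qed.

Lemma BE_epsw_onew k m : BE A (epsw k) (onew m) = m%:R * (m == k.+1)%:R.
Proof.
rewrite /BE /= size_nseq (eq_bigr (fun _ => (m == k.+1)%:R)).
  by rewrite sumr_const card_ord; case: eqP => [->|_]; rewrite ?mulr1 ?mul0rn ?mulr0.
move=> p _; have pk : (p <= k)%N by rewrite -ltnS.
rewrite drop_nseq take_nseq_le // par_nseq par_cons /= mul1r.
rewrite -[eps :: _]/(nseq p.+1 eps) -nseqD -(inj_eq onew_inj).
by rewrite (_ : (k - p + p.+1 = k.+1)%N) //; lia.
Qed.

Lemma BE_epsw_epsw k m : BE A (epsw k) (epsw m) = 0.
Proof. by rewrite /BE /= big1 // => p _; rewrite mulr0. Qed.

Lemma BE_onew k y : reduced A y -> BE A (onew k) y = 0.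
Proof.
move=> yr; rewrite /BE /= big1 // => p _.
case: eqP => [yE|]; last by rewrite mulr0.
by move: yr; rewrite yE /reduced /= mem_cat inE eqxx orbT.
Qed.

Section Cochain.
Variables (phi : cochain R gen) (f : nat -> R).
Hypothesis phiE : forall k s, phi (nseq k eps) s = if s is e1 then f k else 0.

(** The values of [phi] are multiples of the unit, and they are inserted in a slot
where the unit is killed. *)
Lemma B11E_reduced x y : reduced A x -> reduced A y -> B11E A phi x y = 0.
Proof.
case: x => a0 w /e1_notinP /= ->; move: (size w) => {w} k yr.
rewrite /B11E size_nseq big1 // => r _; rewrite big1 // => q qr.
have rk : (r <= k)%N by rewrite -ltnS.
rewrite big1 // => p pq; rewrite sum_gen !slice_nseq ?(leq_trans qr) //.
rewrite !phiE mulr0 mul0r addr0.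
case: eqP => [yE|]; last by rewrite mulr0.
by move: yr; rewrite yE /reduced /= mem_cat inE eqxx orbT.
Qed.

(** As [phi] produces a unit, [mu] has to be the product of that unit with the
0-th letter; what is left is the removal of the letters fed to [phi]. *)
Lemma b11E_word a k y : reduced A y ->
  b11E A phi (a, nseq k eps) y =
  if (y.1 == a) && (size y.2 <= k)%N then f (k - size y.2)%N else 0.
Proof.
move=> yr; rewrite /b11E size_nseq.
have termE (r q p j : 'I_k.+1) : (q <= r)%N -> (p <= q)%N -> (j <= p)%N ->
    \sum_s \sum_s' (-1) ^+ koszul
      [:: (0, true);
          (3, \big[addb/false]_(b <- slice p q (nseq k eps)) spar A b);
          (1, true);
          (4, \big[addb/false]_(b <- drop q (nseq k eps)) spar A b);
          (2, \big[addb/false]_(b <- a :: take p (nseq k eps)) spar A b)]%N *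
    phi (slice q r (nseq k eps)) s *
    mu A (slice p q (nseq k eps) ++ s :: drop r (nseq k eps) ++
          a :: take j (nseq k eps)) s' *
    (y == (s', slice j p (nseq k eps)))%:R =
    if [&& r == k :> nat, p == q :> nat, j == 0 :> nat & y == (a, nseq p eps)]
    then f (k - p)%N else 0.
  move=> qr pq jp; have rk : (r <= k)%N by rewrite -ltnS.
  have qk := leq_trans qr rk; have pk := leq_trans pq qk.
  rewrite !drop_nseq !take_nseq_le // ?(leq_trans jp) // !slice_nseq //.
  rewrite par_nseq par_cons sum_gen !phiE.
  rewrite [X in _ + X]big1 ?addr0; last by move=> s' _; rewrite mulr0 !mul0r.
  have -> : koszul [:: (0, true); (3, false); (1, true);
      (4, \big[addb/false]_(a1 <- nseq (k - q) eps) spar A a1);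
      (2, ~~ is_eps a)]%N = false.
    by rewrite par_nseq; case: a.
  rewrite /= expr0; under eq_bigr => s' _ do rewrite mul1r.
  have [rE|rk'] := eqVneq (r : nat) k; last first.
    rewrite big1 //= => s' _.
    rewrite eps_mu_e1 ?mulr0 ?mul0r // ?mem_cat ?inE ?eqxx ?orbT //.
    rewrite size_cat /= size_cat /= !size_nseq; lia.
  have [pE|pq'] := eqVneq (p : nat) q; last first.
    rewrite big1 //= => s' _.
    rewrite eps_mu_e1 ?mulr0 ?mul0r // ?mem_cat ?inE ?eqxx ?orbT //.
    rewrite size_cat /= size_cat /= !size_nseq; lia.
  have [jE|j0] := eqVneq (j : nat) 0%N; last first.
    rewrite big1 //= => s' _.
    rewrite eps_mu_e1 ?mulr0 ?mul0r // ?mem_cat ?inE ?eqxx ?orbT //.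
    rewrite size_cat /= size_cat /= !size_nseq; lia.
  rewrite rE pE jE !subnn subn0 /= -pE.
  rewrite sum_gen /eps_mu; case: a => /=; rewrite ?eqxx /=.
    by rewrite mulr0 mul0r addr0 mulr1; case: ifP => _; rewrite ?mulr1 ?mulr0.
  by rewrite mulr0 mul0r add0r mulr1; case: ifP => _; rewrite ?mulr1 ?mulr0.
transitivity (\sum_(r < k.+1) \sum_(q < k.+1 | (q <= r)%N)
    \sum_(p < k.+1 | (p <= q)%N) \sum_(j < k.+1 | (j <= p)%N)
    if [&& r == k :> nat, p == q :> nat, j == 0 :> nat & y == (a, nseq p eps)]
    then f (k - p)%N else 0).
  apply: eq_bigr => r _; apply: eq_bigr => q qr; apply: eq_bigr => p pq.
  by apply: eq_bigr => j jp; apply: termE.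
case: ifPn => [/andP[/eqP ya yk]|yna].
  have yE : y = (a, nseq (size y.2) eps).
    by rewrite -{}ya; case: (y) yr => b w /e1_notinP /= {1}->.
  have yk' : (size y.2 < k.+1)%N by [].
  rewrite (@sum_only1 _ _ ord_max) //; last first.
    move=> r _ rne; rewrite big1 // => q _; rewrite big1 // => p _.
    rewrite big1 // => j _; case: ifP => // /and4P[/eqP rE _ _ _].
    by case/eqP: rne; apply/val_inj.
  rewrite (@sum_only1 _ _ (Ordinal yk')) //; last first.
    move=> q _ qne; rewrite big1 // => p _.
    rewrite big1 // => j _; case: ifP => // /and4P[_ /eqP pE _ /eqP].
    rewrite {1}yE => -[] /(congr1 size); rewrite !size_nseq => pE'.
    by case/eqP: qne; apply/val_inj; rewrite /= -pE.
  rewrite (@sum_only1 _ _ (Ordinal yk')) //; last first.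
    move=> p _ pne; rewrite big1 // => j _; case: ifP => // /and4P[_ /eqP pE _ _].
    by case/eqP: pne; apply/val_inj.
  rewrite (@sum_only1 _ _ ord0) //; last first.
    move=> j _ jne; case: ifP => // /and4P[_ _ /eqP jE _].
    by case/eqP: jne; apply/val_inj.
  by rewrite /= !eqxx /= -yE eqxx.
rewrite big1 // => r _; rewrite big1 // => q _; rewrite big1 // => p _.
rewrite big1 // => j _; case: ifP => // /and4P[_ _ _ /eqP yE].
by move: yna; rewrite yE /= eqxx size_nseq -ltnS ltn_ord.
Qed.

End Cochain.

(** * Action on chains, coboundaries and the support of the Mukai pairing *)

(** The matrices of [b] and of [b11E] are Toeplitz: their entries depend on the
difference of the two lengths only. *)
Lemma sum_shift m N (z c : nat -> R) :
  \sum_(k < m + N) z k * (if (m <= k)%N then c (k - m)%N else 0) =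
  \sum_(i < N) c i * z (m + i)%N.
Proof.
rewrite big_split_ord /= big1 ?add0r.
  by apply: eq_bigr => i _; rewrite leq_addr addKn mulrC.
by move=> i _; rewrite leqNgt ltn_ord mulr0.
Qed.

Lemma apply_BE_onew z m : apply A (BE A) z (onew m) = m%:R * z (epsw m.-1).
Proof.
rewrite (@apply_sum m) ?reduced_onew //; first last.
- by move=> k _; rewrite BE_onew ?reduced_onew.
- by move=> k mk; rewrite BE_epsw_onew; case: eqP => [E|]; [lia|rewrite mulr0].
under eq_bigr => k _ do
  rewrite BE_epsw_onew BE_onew ?reduced_onew // mulr0 addr0.
case: m => [|m]; first by rewrite big_ord0 mul0r.
rewrite (@sum_only1 _ _ ord_max) //= ?eqxx ?mulr1 1?mulrC // => k _ km.
case: eqP => [[mk]|]; last by rewrite !mulr0.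
by case/eqP: km; apply/val_inj.
Qed.

Lemma apply_BE_epsw z m : apply A (BE A) z (epsw m) = 0.
Proof.
rewrite (@apply_sum 0) ?reduced_epsw ?big_ord0 // => k _.
  exact: BE_epsw_epsw.
exact/BE_onew/reduced_epsw.
Qed.

Lemma apply_bE_epsw z m : apply A (bE A) z (epsw m) = 0.
Proof.
rewrite (@apply_sum 0) ?reduced_epsw ?big_ord0 // => k _.
  exact: bE_epsw_epsw.
exact/bE_onew/reduced_epsw.
Qed.

Section Cochain.
Variables (phi : cochain R gen) (f : nat -> R) (N : nat).
Hypothesis phiE : forall k s, phi (nseq k eps) s = if s is e1 then f k else 0.
Hypothesis f0 : forall k, (N <= k)%N -> f k = 0.

Lemma apply_B11E z y : apply A (B11E A phi) z y = 0.
Proof.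
have [yr|yn] := boolP (reduced A y); last exact: apply_nonreduced.
rewrite (@apply_sum 0) ?big_ord0 // => k _.
  by apply: (B11E_reduced phiE) => //; apply: reduced_epsw.
by apply: (B11E_reduced phiE) => //; apply: reduced_onew.
Qed.

Lemma apply_b11E z a m :
  apply A (b11E A phi) z (a, nseq m eps) =
  \sum_(i < N) f i * z (a, nseq (m + i) eps).
Proof.
have yr : reduced A (a, nseq m eps) by exact: e1_notin_nseq.
rewrite (@apply_sum (m + N)) //; first last.
- move=> k mk; rewrite (b11E_word phiE) //= size_nseq; case: ifP => // _.
  by rewrite f0 //; lia.
- move=> k mk; rewrite (b11E_word phiE) //= size_nseq; case: ifP => // _.
  by rewrite f0 //; lia.
rewrite -(sum_shift m N (fun k => z (a, nseq k eps))); apply: eq_bigr => k _.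
rewrite !(b11E_word phiE) //= size_nseq.
by case: a {yr} => /=; rewrite ?mulr0 ?addr0 ?add0r.
Qed.

End Cochain.

Section Coboundary.
Variables (psi : cochain R gen) (psir : cochain_reduced A psi).

Lemma psi_e1 w s : e1 \in w -> psi w s = 0.
Proof. exact: psir. Qed.

Lemma mu_e1_nseq p r s : s = e1 ->
  eps_mu T (nseq p eps ++ e1 :: nseq r eps) s = 0.
Proof.
move=> ->; have [p2|] := eqVneq (size (nseq p eps ++ e1 :: nseq r eps)) 2%N.
  move: p2; rewrite size_cat /= !size_nseq.
  move=> pr; have {pr}: (p = 0 /\ r = 1 \/ p = 1 /\ r = 0)%N by lia.
  by case=> -[-> ->]; rewrite /eps_mu /= ?oppr0.
by apply: eps_mu_e1; rewrite mem_cat inE eqxx orbT.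
Qed.

(** The coboundary of psi(x) = sum_i psi_i x^i is the product psi W'. *)
Lemma hdelta_e1 k : hdelta A psi (nseq k eps) e1 =
  \sum_(i < k.+1) psi (nseq i eps) eps * dpot (k - i).
Proof.
rewrite /hdelta size_nseq; under [RHS]eq_bigr => i _ do
  rewrite /dpot mulrCA mulr_natl.
rewrite -(sum_sub_le k (fun i => psi (nseq i eps) eps * T (k - i).+1)).
apply: eq_bigr => q _; apply: eq_bigr => p pq.
have qk : (q <= k)%N by rewrite -ltnS.
have pk := leq_trans pq qk.
rewrite sum_gen /= slice_nseq // drop_nseq take_nseq_le // !par_nseq.
rewrite !eps_mu_nseq !mu_e1_nseq // [psi (_ ++ e1 :: _) _]psi_e1; last first.
  by rewrite mem_cat inE eqxx orbT.
rewrite !mulr0 subr0 add0r mul0r subr0 expr0 mul1r.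
rewrite -[eps :: nseq _ _]/(nseq (k - q).+1 eps) -nseqD eps_mu_nseq.
by congr (_ * T _); lia.
Qed.

Lemma hdelta_eps k : (forall w, psi w e1 = 0) ->
  hdelta A psi (nseq k eps) eps = 0.
Proof.
move=> psi0; rewrite /hdelta size_nseq.
rewrite big1 // => q _; rewrite big1 // => p pq.
have qk : (q <= k)%N by rewrite -ltnS.
have pk := leq_trans pq qk.
rewrite sum_gen /= slice_nseq // drop_nseq take_nseq_le // !eps_mu_nseq.
rewrite psi0 [psi (_ ++ e1 :: _) _]psi_e1 ?mem_cat ?inE ?eqxx ?orbT //.
rewrite -[eps :: nseq _ _]/(nseq (k - q).+1 eps) -nseqD eps_mu_nseq.
by rewrite !mulr0 !mul0r !subr0 addr0.
Qed.

End Coboundary.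

Section Bounded.
Variable n : nat.
Hypothesis T0 : forall k, (n.+1 < k)%N -> T k = 0.

Lemma dpot0 i : (n < i)%N -> dpot i = 0.
Proof. by move=> ni; rewrite /dpot T0 ?mulr0. Qed.

Lemma apply_bE_onew z m :
  apply A (bE A) z (onew m) = \sum_(i < n.+1) dpot i * z (epsw (m + i)).
Proof.
rewrite (@apply_sum (m + n.+1)) ?reduced_onew //; first last.
- by move=> k _; rewrite bE_onew ?reduced_onew.
- by move=> k mk; rewrite bE_epsw_onew; case: ifP => // _; rewrite dpot0 //; lia.
rewrite -(sum_shift m n.+1 (fun k => z (epsw k))); apply: eq_bigr => k _.
by rewrite bE_epsw_onew bE_onew ?reduced_onew // mulr0 addr0.
Qed.

Hypothesis n_gt0 : (0 < n)%N.

Local Notation par w := (\big[addb/false]_(a <- w) spar A a).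

(** The structure maps are odd, and a unit among the inputs forces the arity 2. *)
Lemma eps_mu_supp w s : eps_mu T w s != 0 ->
  [/\ spar A s = ~~ par w, e1 \in w -> size w = 2%N & (size w <= n.+1)%N].
Proof.
have [ew|/e1_notinP->] := boolP (e1 \in w); last first.
  rewrite eps_mu_nseq par_nseq size_nseq.
  case: s; rewrite ?eqxx // => Tn; split=> //.
  by rewrite leqNgt; apply: contra Tn => /T0 ->.
have [w2|w2] := eqVneq (size w) 2%N; last by rewrite eps_mu_e1 ?eqxx.
move=> mu0; split=> //; last by rewrite w2.
move: mu0 ew w2; case: w => [|[] [|[] [|c w]]] //=; rewrite !big_cons big_nil;
  by case: s; rewrite /eps_mu /= ?oppr0 ?eqxx.
Qed.

Lemma cyc_supp w a : cyc A w a != 0 ->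
  [/\ spar A a = par w, e1 \in w -> size w = 2%N & (size w <= n.+1)%N].
Proof.
rewrite /cyc sum_gen /= => ca; have [mu1|mu1] := eqVneq (eps_mu T w e1) 0.
  have /eps_mu_supp[pw w2 wn] : eps_mu T w eps != 0.
    by apply: contraNneq ca => ->; rewrite mu1 !mul0r addr0.
  have {}pw : par w = true by case: (par w) pw.
  split=> //; rewrite pw; case: a ca => //=.
  by rewrite mu1 mul0r mulr0 addr0 eqxx.
have /eps_mu_supp[pw' w2 wn] := mu1.
have {pw'}pw : par w = false by case: (par w) pw'.
split=> //; rewrite pw.
have mu2 : eps_mu T w eps = 0.
  by apply/eqP; apply: contraFT pw => /eps_mu_supp[]; case: (par w).
by case: a ca => //=; rewrite mu2 mulr0 mul0r add0r eqxx.
Qed.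

(** Comparing parities in the two factors gives [a0 = b0]. Together the two words
have i + j + 4 letters: a word containing the unit has 2, any other one at most
n + 1. If [a0] is the unit, both words contain a unit; otherwise exactly one
does, since [s] and [s'] have opposite parities. *)
Lemma muk_term_supp a0 b0 (i j p q p' q' : nat) s t s' t' (c : R) :
  (p <= q <= i)%N -> (p' <= q' <= j)%N ->
  c * eps_form R s s' * eps_form R t t' *
    cyc A (nseq (i - q) eps ++ a0 :: nseq p eps ++ s :: nseq (q' - p') eps) t *
    cyc A (nseq (j - q') eps ++ b0 :: nseq p' eps ++ s' :: nseq (q - p) eps) t'
    != 0 ->
  a0 = b0 /\ (if a0 is e1 then (i + j = 0)%N else (i + j < n)%N).
Proof.
move=> /andP[pq qi] /andP[pq' qj] N0.
have ss : spar A s' = ~~ spar A s.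
  by case: s s' N0 => [] [] //=; rewrite !(mulr0, mul0r) eqxx.
have tt : spar A t' = ~~ spar A t.
  by case: t t' N0 => [] [] //=; rewrite !(mulr0, mul0r) eqxx.
have /cyc_supp[pt w12 w1n] :
    cyc A (nseq (i - q) eps ++ a0 :: nseq p eps ++ s :: nseq (q' - p') eps) t != 0.
  by apply: contraNneq N0 => ->; rewrite mulr0 mul0r.
have /cyc_supp[pt' w22 w2n] :
    cyc A (nseq (j - q') eps ++ b0 :: nseq p' eps ++ s' :: nseq (q - p) eps) t' != 0.
  by apply: contraNneq N0 => ->; rewrite mulr0.
have ab : a0 = b0.
  move: tt; rewrite pt pt' !(big_cat, big_cons) !par_nseq ss.
  by case: a0 {N0 pt w12 w1n}; case: b0 {pt' w22 w2n}; case: s {ss}.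
split=> //; move: w12 w22 w1n w2n; rewrite -{}ab !mem_cat !inE !mem_cat !inE.
rewrite !size_cat /= !size_cat /= !size_nseq.
case: a0 {N0 pt pt'} => /=; rewrite ?orbT.
  by move=> /(_ isT) H1 /(_ isT) H2 _ _; lia.
case: s ss => /=; case: s' => //= _; rewrite ?orbT.
  by move=> /(_ isT) H1 _ _ H2; lia.
by move=> _ /(_ isT) H1 H2 _; lia.
Qed.

(** Two terms survive, [s] being the unit in one and eps in the other, and their
signs are opposite. *)
Lemma mukE_onew0 : mukE A (onew 0) (onew 0) = 0.
Proof.
rewrite /mukE /= !big_ord1 !big_mkcond !big_ord1 /=.
rewrite [LHS]big_mkcond big_ord1 /= /slice /=.
rewrite !sum_gen /cyc !sum_gen /eps_mu /=.
rewrite !(big_cons, big_nil) /=.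
rewrite !(mul0r, mulr0, mul1r, mulr1, add0r, addr0, expr0, expr1).
ring.
Qed.

Lemma mukE_supp x y : reduced A x -> reduced A y -> mukE A x y != 0 ->
  exists i j, [/\ x = epsw i, y = epsw j & (i + j < n)%N].
Proof.
case: x y => [a0 a] [b0 b] ar br.
have aE : a = nseq (size a) eps by exact: (e1_notinP ar).
have bE : b = nseq (size b) eps by exact: (e1_notinP br).
rewrite aE bE {aE bE}; move: (size a) (size b) => i j {ar br}.
have [/andP[/eqP <-]|bad] :=
    boolP ((a0 == b0) && if a0 is e1 then (i + j == 0)%N else (i + j < n)%N).
  case: a0; last by move=> ijn _; exists i, j.
  rewrite addn_eq0 => /andP[/eqP -> /eqP ->].
  by move/eqP; case; apply: mukE_onew0.
suff -> : mukE A (a0, nseq i eps) (b0, nseq j eps) = 0 by rewrite eqxx.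
rewrite /mukE !size_nseq.
rewrite big1 // => q _; rewrite big1 // => p pq.
rewrite big1 // => q' _; rewrite big1 // => p' pq'.
have qi : (q <= i)%N by rewrite -ltnS.
have qj : (q' <= j)%N by rewrite -ltnS.
rewrite big1 // => s _; rewrite big1 // => t _.
rewrite big1 // => s' _; rewrite big1 // => t' _.
apply/eqP; apply: contraNT bad; rewrite !drop_nseq !slice_nseq //.
rewrite !take_nseq_le ?(leq_trans pq) ?(leq_trans pq') //.
case/muk_term_supp; rewrite ?pq ?pq' // => <-; rewrite eqxx.
by case: a0 => // ->.
Qed.

Lemma mukai_eq0l z w : (forall k, (k < n)%N -> z (epsw k) = 0) ->
  mukai A z w = 0.
Proof.
move=> z0; apply: fsbig1 => -[x y] /= [xr yr].
have [->|/mukE_supp[]//] := eqVneq (mukE A x y) 0; first by rewrite mulr0.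
by move=> i [j [-> _ ijn]]; rewrite z0 ?mul0r // (leq_ltn_trans (leq_addr j i)).
Qed.

Lemma mukai_eq0r z w : (forall k, (k < n)%N -> w (epsw k) = 0) ->
  mukai A z w = 0.
Proof.
move=> z0; apply: fsbig1 => -[x y] /= [xr yr].
have [->|/mukE_supp[]//] := eqVneq (mukE A x y) 0; first by rewrite mulr0.
by move=> i [j [_ -> ijn]]; rewrite z0 ?mulr0 ?mul0r // (leq_ltn_trans (leq_addl i j)).
Qed.

End Bounded.
End EpsAlgebra.

(** * The twisted differential W' - u d/dx *)

Section Recursion.
Variables (R : comNzRingType) (n : nat) (W : nat -> R).
Hypotheses (n_gt0 : (0 < n)%N) (Wn : W n = 1).
Implicit Types (x init src : int -> nat -> R).

(** With [x l k] the coefficient of u^l x^(-k-1), this is the coefficient of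
u^l x^(-m-1) in (W' - u d/dx) x. *)
Definition twisted x : int -> nat -> R := fun l m =>
  \sum_(i < n.+1) W i * x l (m + i)%N + m%:R * x (l - 1) m.-1.

Lemma twisted_rec x l m : x l (m + n)%N =
  twisted x l m - (\sum_(i < n) W i * x l (m + i)%N + m%:R * x (l - 1) m.-1).
Proof.
by rewrite /twisted big_ord_recr /= Wn mul1r; ring.
Qed.

Lemma twisted_ind (P : int -> nat -> Prop) :
  (forall l k, (k < n)%N -> P l k) ->
  (forall l m, (forall i, (i < n)%N -> P l (m + i)%N) ->
     ((0 < m)%N -> P (l - 1) m.-1) -> P l (m + n)%N) ->
  forall l k, P l k.
Proof.
move=> P0 PS l k; elim/ltn_ind: k l => k IH l.
have [kn|nk] := ltnP k n; first exact: P0.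
rewrite -(subnK nk); apply: PS => [i ilt|m0]; apply: IH; lia.
Qed.

Lemma twisted_inj x x' : (forall l k, (k < n)%N -> x l k = x' l k) ->
  (forall l m, twisted x l m = twisted x' l m) -> forall l k, x l k = x' l k.
Proof.
move=> xx tt; apply: twisted_ind => [//|l m IHl IHp].
rewrite !twisted_rec tt; congr (_ - (_ + _)).
  by apply: eq_bigr => i _; rewrite IHl.
by case: m IHp {IHl} => [|m] IHp; rewrite ?mul0r // IHp.
Qed.

(** Recursion on [k], for all exponents [l] at once; any fuel above [k] will do. *)
Fixpoint solve_fuel init src N l k : R :=
  if N is N'.+1 then
    if (k < n)%N then init l k else
    src l (k - n)%N - (\sum_(i < n) W i * solve_fuel init src N' l (k - n + i)%N
                + (k - n)%:R * solve_fuel init src N' (l - 1) (k - n).-1)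
  else 0.

Lemma solve_fuelE init src N l k : (k < N)%N ->
  solve_fuel init src N l k = solve_fuel init src k.+1 l k.
Proof.
elim: N {-2}N (leqnn N) l k => [|M IH] [|N] // NM l k kN.
rewrite [LHS]/= [RHS]/=; case: ifPn => // nk; congr (_ - (_ + _)).
  apply: eq_bigr => i _; have ilt := ltn_ord i; congr (_ * _).
  by rewrite [LHS]IH 1?[RHS]IH //; lia.
by congr (_ * _); rewrite [LHS]IH 1?[RHS]IH //; lia.
Qed.

Lemma twisted_solve init src : exists x,
  (forall l k, (k < n)%N -> x l k = init l k) /\
  (forall l m, twisted x l m = src l m).
Proof.
exists (fun l k => solve_fuel init src k.+1 l k); split=> [l k kn|l m].
  by rewrite /= kn.
rewrite /twisted big_ord_recr Wn mul1r.
have -> : solve_fuel init src (m + n).+1 l (m + n) = src l m -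
    (\sum_(i < n) W i * solve_fuel init src (m + n) l (m + i)%N
     + m%:R * solve_fuel init src (m + n) (l - 1) m.-1).
  by rewrite /= ltnNge leq_addl /= addnK.
have -> : \sum_(i < n) W i * solve_fuel init src (m + n) l (m + i)%N =
  \sum_(i < n) W i * solve_fuel init src (m + i).+1 l (m + i)%N.
  by apply: eq_bigr => i _; rewrite solve_fuelE //; have := ltn_ord i; lia.
rewrite [solve_fuel _ _ (m + n) (l - 1) _]solve_fuelE; last lia.
move: (solve_fuel _ _ _ (l - 1) _) => c; rewrite /=.
by set S := \sum_(i < n) _; ring.
Qed.

End Recursion.

(** * Adic completeness *)

Section AdicSequences.
Variables (n : nat) (K : fieldType).
Local Notation R := (mps n K).

Definition adic_seq (s : nat -> R) :=
  forall N, exists k0, forall k, (k0 <= k)%N -> max_pow N (s k).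

Section Chains.
Variable T : nat -> R.
Local Notation A := (eps_ainf T).

(** There are two reduced words of each length, so finiteness of a set of reduced
words is boundedness of their lengths. *)
Lemma adic_chainsP (z : chain R gen) : adic_chains A z <->
  [/\ forall y, ~~ reduced A y -> z y = 0,
      adic_seq (fun k => z (epsw k)) & adic_seq (fun k => z (onew k))].
Proof.
split=> [[z0 zf]|[z0 zE zU]].
  have bound N : exists k0, forall y, ~ max_pow N (z y) -> (size y.2 < k0)%N.
    have /finite_seqP[r rE] := zf N.
    exists (\max_(y <- r) size y.2).+1 => y yN.
    have yr : y \in r by have : [set` r]%classic y by rewrite -rE.
    by rewrite ltnS; apply: (leq_bigmax_seq (F := fun y : word gen => size y.2)).
  split=> // N; have [k0 k0P] := bound N; exists k0 => k kk;
    by apply: contrapT => /k0P /=; rewrite size_nseq; lia.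
split=> // N; have [k1 z1] := zE N; have [k2 z2] := zU N.
apply: (@sub_finite_set _ _
  [set` map epsw (iota 0 k1) ++ map onew (iota 0 k2)]%classic).
  move=> y /= yN; have yr : reduced A y.
    apply: contrapT => /negP /z0 y0; apply: yN; rewrite y0; exact: max_pow_zero.
  case/reducedP: yr => yE; rewrite yE in yN *; rewrite mem_cat.
    rewrite (map_f epsw) // mem_iota leq0n ltnNge; apply/negP => yk.
    by apply: yN; apply: z1.
  rewrite (map_f onew) ?orbT // mem_iota leq0n ltnNge; apply/negP => yk.
  by apply: yN; apply: z2.
exact: finite_seq.
Qed.

End Chains.

Lemma adic_seqD s s' : adic_seq s -> adic_seq s' -> adic_seq (fun k => s k + s' k).
Proof.
move=> sa sa' N; have [k1 H1] := sa N; have [k2 H2] := sa' N.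
by exists (k1 + k2)%N => k kk; apply: max_powD; [apply: H1|apply: H2]; lia.
Qed.

Lemma adic_seq_mono (s s' : nat -> R) : adic_seq s ->
  (forall N k, max_pow N (s k) -> max_pow N (s' k)) -> adic_seq s'.
Proof.
move=> sa ss' N; have [k1 H1] := sa N.
by exists k1 => k kk; apply/ss'/H1.
Qed.

Lemma adic_seqN s : adic_seq s -> adic_seq (fun k => - s k).
Proof. by move=> sa; apply: adic_seq_mono sa _ => N k; apply: max_powN. Qed.

Lemma adic_seqB s s' : adic_seq s -> adic_seq s' -> adic_seq (fun k => s k - s' k).
Proof. by move=> sa sa'; apply: adic_seqD => //; apply: adic_seqN. Qed.

Lemma adic_seqZ (a : K) s : adic_seq s -> adic_seq (fun k => a *: s k).
Proof. by move=> sa; apply: adic_seq_mono sa _ => N k; apply: max_powZ. Qed.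

Lemma adic_seqM (a : nat -> R) s : adic_seq s -> adic_seq (fun k => a k * s k).
Proof. by move=> sa; apply: adic_seq_mono sa _ => N k; apply: max_powMl. Qed.

Lemma adic_seq0 : adic_seq (fun=> 0).
Proof. by move=> N; exists 0%N => k _; apply: max_pow_zero. Qed.

Lemma adic_seq_shift d s : adic_seq s -> adic_seq (fun k => s (k + d)%N).
Proof.
by move=> sa N; have [k1 H1] := sa N; exists k1 => k kk; apply: H1; lia.
Qed.

Lemma adic_seq_sum N (F : nat -> nat -> R) :
  (forall i, adic_seq (F i)) -> adic_seq (fun k => \sum_(i < N) F i k).
Proof.
move=> Fa; elim: N => [|N IH].
  apply: adic_seq_mono adic_seq0 _ => N k _; rewrite big_ord0; exact: max_pow_zero.
apply: adic_seq_mono (adic_seqD IH (Fa N)) _ => M k.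
by rewrite big_ord_recr.
Qed.

End AdicSequences.

Section Adic.
Variables (n : nat) (K : fieldType) (W : nat -> mps n K).
Hypotheses (n_gt0 : (0 < n)%N) (Wn : W n = 1).
Hypothesis W1 : forall i, (i < n)%N -> max_pow 1 (W i).
Local Notation R := (mps n K).
Local Notation twisted := (twisted n W).

Definition laurent_seq (x : int -> nat -> R) :=
  (forall l, adic_seq (x l)) /\
  forall N, exists l0 : int, forall l k, (l < l0)%R -> max_pow N (x l k).

(** The recursion never increases the exponent of u, so it can be run below l0
alone. *)
Lemma twisted_max_pow N (l0 : int) x :
  (forall l k, (l < l0)%R -> (k < n)%N -> max_pow N (x l k)) ->
  (forall l m, (l < l0)%R -> max_pow N (twisted x l m)) ->
  forall l k, (l < l0)%R -> max_pow N (x l k).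
Proof.
move=> x0 tx; apply: (twisted_ind n_gt0) => [l k kn ll|l m IHl IHp ll].
  exact: x0.
rewrite (twisted_rec Wn); apply: max_powB; first exact: tx.
apply: max_powD.
  by apply: max_pow_sum => i _; apply: max_powMl; apply: IHl.
case: m IHp {IHl} => [|m] IHp; first by rewrite mul0r; apply: max_pow_zero.
by apply: max_powMl; apply: IHp => //; lia.
Qed.

(** Fix a power of the maximal ideal. Below some exponent l0 of u all the
coefficients lie in it by [twisted_max_pow]. Above l0, induct on the power and
on l: in the recursion for [x l], the terms in [x l] itself gain a power from
the lower coefficients of W', and the remaining ones belong to the source or to
[x (l - 1)]. *)
Lemma twisted_laurent x :
  (forall N, exists l0 : int, forall l k, (l < l0)%R -> (k < n)%N ->
     max_pow N (x l k)) ->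
  laurent_seq (twisted x) -> laurent_seq x.
Proof.
move=> x0 [tadic tlow].
have xlow N : exists l0 : int, forall l k, (l < l0)%R -> max_pow N (x l k).
  have [l1 x1] := x0 N; have [l2 x2] := tlow N.
  exists (Num.min l1 l2); apply: twisted_max_pow => [l k|l m].
    by rewrite lt_min => /andP[? _]; apply: x1.
  by rewrite lt_min => /andP[_ ?]; apply: x2.
split=> // l N; elim: N l => [|N IHN] l; first by exists 0%N.
have [l0 xl0] := xlow N.+1.
have [ll0|] := ltP l l0; first by exists 0%N => k _; apply: xl0.
(* write l = l0 + d and induct on d *)
rewrite -subr_ge0; case dE: (l - l0) => [d|//] _.
have {dE}-> : l = l0 + d%:Z by lia.
elim: d => [|d [k1 IHd]].
  have [k2 IHN0] := IHN (l0 + 0); have [k3 src] := tadic (l0 + 0) N.+1.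
  exists (k2 + k3 + n)%N => k kk; rewrite -(@subnK n k); last by lia.
  rewrite (twisted_rec Wn); apply: max_powB; first by apply: src; lia.
  apply: max_powD; last by apply: max_powMl; apply: xl0; lia.
  apply: max_pow_sum => i _; rewrite -add1n; apply: max_powM.
    exact: W1.
  by apply: IHN0; lia.
have [k2 IHN0] := IHN (l0 + d.+1); have [k3 src] := tadic (l0 + d.+1) N.+1.
exists (k1 + k2 + k3 + n + 1)%N => k kk; rewrite -(@subnK n k); last by lia.
rewrite (twisted_rec Wn); apply: max_powB; first by apply: src; lia.
apply: max_powD; last first.
  apply: max_powMl; rewrite (_ : l0 + d.+1 - 1 = l0 + d); last by lia.
  by apply: IHd; lia.
apply: max_pow_sum => i _; rewrite -add1n; apply: max_powM.
  exact: W1.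
by apply: IHN0; lia.
Qed.

End Adic.

(** * The versal deformation and its completed homologies *)

Definition epart (R : comNzRingType) (z : uchain R gen) : int -> nat -> R :=
  fun l k => z l (epsw k).

Lemma bB_epsw (R : comNzRingType) (T : nat -> R) (z : uchain R gen) l m :
  bB (eps_ainf T) z l (epsw m) = 0.
Proof. by rewrite /bB apply_bE_epsw apply_BE_epsw addr0. Qed.

Lemma bB_nonreduced (R : comNzRingType) (T : nat -> R) (z : uchain R gen) l y :
  ~~ reduced (eps_ainf T) y -> bB (eps_ainf T) z l y = 0.
Proof. by move=> yn; rewrite /bB !apply_nonreduced ?addr0. Qed.

Lemma bB_onew (R : comNzRingType) (T : nat -> R) n (z : uchain R gen) l m :
  (forall k, (n.+1 < k)%N -> T k = 0) ->
  bB (eps_ainf T) z l (onew m) = twisted n (dpot T) (epart z) l m.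
Proof.
by move=> T0; rewrite /bB (apply_bE_onew T0) apply_BE_onew.
Qed.

Lemma chain_ext (R : comNzRingType) (T : nat -> R) (c c' : chain R gen) :
  (forall y, ~~ reduced (eps_ainf T) y -> c y = c' y) ->
  (forall k, c (epsw k) = c' (epsw k)) -> (forall k, c (onew k) = c' (onew k)) ->
  c = c'.
Proof.
move=> cn cE cU; apply/funext => y.
have [/reducedP[]->|/cn//] := boolP (reduced (eps_ainf T) y).
  exact: cE.
exact: cU.
Qed.

Section Versal.
Variables (K : fieldType) (n : nat).
Local Notation R := (mps n K).

Definition versal_pot (k : nat) : R :=
  if k == n.+1 then mps_const n (n.+1%:R^-1)
  else if insub k is Some i then mps_var K i else 0.

Local Notation A := (eps_ainf versal_pot).
Local Notation W := (dpot versal_pot).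
Local Notation tw := (twisted n W).

Lemma versal_pot_var (i : 'I_n) : versal_pot i = mps_var K i.
Proof.
rewrite /versal_pot valK ifF //; apply/negbTE; have := ltn_ord i; lia.
Qed.

Lemma versal_pot_top : versal_pot n.+1 = mps_const n (n.+1%:R^-1).
Proof. by rewrite /versal_pot eqxx. Qed.

Lemma versal_pot0 k : (n <= k)%N -> k != n.+1 -> versal_pot k = 0.
Proof. by move=> nk /negbTE kn; rewrite /versal_pot kn insubF // ltnNge nk. Qed.

Lemma versal_pot_big k : (n.+1 < k)%N -> versal_pot k = 0.
Proof. by move=> nk; apply: versal_pot0; lia. Qed.

Lemma W1 i : (i < n)%N -> max_pow 1 (W i).
Proof.
move=> ilt; apply: max_powMl.
have [i1|i1] := ltnP i.+1 n.
  by rewrite (versal_pot_var (Ordinal i1)); apply: max_pow_var.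
by rewrite versal_pot0 //; [exact: max_pow_zero|lia].
Qed.

Hypothesis charK : [pchar K] =i pred0.

Lemma nK_neq0 : (n.+1%:R : K) != 0. Proof. exact: natS_neq0. Qed.

Lemma Wn : W n = 1.
Proof.
rewrite /dpot versal_pot_top mps_const_scale mps_natZ scalerA divff ?scale1r //.
exact: nK_neq0.
Qed.

Hypothesis n_gt0 : (0 < n)%N.

(** W' - u d/dx is onto: solve the recursion with vanishing coefficients for
k < n. The same solution serves HC^- and HH, as it inherits the vanishing of
the negative powers of u, and HP. *)
Lemma bB_surj (D : uchain R gen) : adic_laurent A D ->
  (forall l k, D l (epsw k) = 0) ->
  exists eta, [/\ adic_laurent A eta, D = bB A eta &
    (forall l, (l < 0)%R -> D l = 0) -> forall l, (l < 0)%R -> eta l = 0].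
Proof.
move=> [Da Dl] DE.
have [x [x0 tx]] := twisted_solve n_gt0 Wn (fun _ _ => 0) (fun l m => D l (onew m)).
pose eta : uchain R gen := fun l y =>
  if is_eps y.1 && reduced A y then x l (size y.2) else 0.
have etaE l k : eta l (epsw k) = x l k.
  by rewrite /eta reduced_epsw /= size_nseq.
have etaU l k : eta l (onew k) = 0 by [].
have xl : laurent_seq x.
  apply: (twisted_laurent n_gt0 Wn W1).
    by move=> N; exists 0 => l k _ kn; rewrite x0 //; apply: max_pow_zero.
  split=> [l N|N].
    have /adic_chainsP[_ _ /(_ N)[k0 H]] := Da l.
    by exists k0 => k kk; rewrite tx; apply: H.
  have [l0 H] := Dl N; exists l0 => l k ll.
  by rewrite tx; apply: H.
exists eta; split.
- split=> [l|N].
    apply/adic_chainsP; split=> [y yn|N|N].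
    + by rewrite /eta (negbTE yn) andbF.
    + have [k0 H] := xl.1 l N; exists k0 => k kk; rewrite etaE; exact: H.
    + by exists 0%N => k _; rewrite etaU; apply: max_pow_zero.
  have [l0 H] := xl.2 N; exists l0 => l y ll; rewrite /eta.
  by case: ifP => _; [apply: H|apply: max_pow_zero].
- apply/funext => l; apply: (chain_ext (T := versal_pot)) => [y yn|k|k].
  + rewrite bB_nonreduced //; have /adic_chainsP[-> //] := Da l.
  + by rewrite bB_epsw.
  + rewrite (bB_onew _ _ _ versal_pot_big) -tx /twisted.
    by congr (_ + _); [apply: eq_bigr => i _|]; rewrite /epart etaE.
- move=> D0 l l0; apply/funext => y; rewrite /eta; case: ifP => // _.
  apply: (@max_pow_inf n K) => N.
  apply: (twisted_max_pow (l0 := 0) n_gt0 Wn) => // l'.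
    by move=> k _ kn; rewrite x0 //; apply: max_pow_zero.
  by move=> m ll; rewrite tx D0 //; apply: max_pow_zero.
Qed.

Lemma adic_chainsD c c' : adic_chains A c -> adic_chains A c' ->
  adic_chains A (c + c').
Proof.
move=> /adic_chainsP[c0 cE cU] /adic_chainsP[c0' cE' cU'].
apply/adic_chainsP; split=> [y yn||].
- by rewrite !fctE c0 ?c0' ?addr0.
- exact: adic_seqD.
- exact: adic_seqD.
Qed.

Lemma adic_chainsB c c' : adic_chains A c -> adic_chains A c' ->
  adic_chains A (c - c').
Proof.
move=> /adic_chainsP[c0 cE cU] /adic_chainsP[c0' cE' cU'].
apply/adic_chainsP; split=> [y yn||].
- by rewrite !fctE c0 ?c0' ?subrr.
- exact: adic_seqB.
- exact: adic_seqB.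
Qed.

Lemma adic_chainsZ (r : K) c : adic_chains A c ->
  adic_chains A (fun y => r *: c y).
Proof.
move=> /adic_chainsP[c0 cE cU]; apply/adic_chainsP; split=> [y yn||].
- by rewrite c0 ?scaler0.
- exact: adic_seqZ.
- exact: adic_seqZ.
Qed.

Lemma adic_chains0 : adic_chains A 0.
Proof.
apply/adic_chainsP; split=> //; exact: adic_seq0.
Qed.

Lemma CCpow_laurent z : CCpow (adic_chains A) z -> adic_laurent A z.
Proof.
move=> [za z0]; split=> // N; exists 0 => l x l0.
by rewrite z0 //; apply: max_pow_zero.
Qed.

Lemma HCm_homologousP z w : CCpow (adic_chains A) z -> CCpow (adic_chains A) w ->
  HCm_homologous A (adic_chains A) z w <-> epart z = epart w.
Proof.
move=> zC wC; split=> [[eta _ zw]|zw].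
  apply/funext => l; apply/funext => k; apply/eqP; rewrite -subr_eq0; apply/eqP.
  have := congr1 (fun c : uchain R gen => c l (epsw k)) zw.
  by rewrite bB_epsw !fctE.
have dC : CCpow (adic_chains A) (z - w).
  split=> [l|l l0]; first exact: adic_chainsB (zC.1 l) (wC.1 l).
  by apply/funext => y; rewrite !fctE zC.2 ?wC.2 ?subrr.
have [|eta [[ea _] e1 e2]] := bB_surj (CCpow_laurent dC).
  move=> l k; have := congr1 (fun c : int -> nat -> R => c l k) zw.
  by rewrite /epart !fctE => ->; rewrite subrr.
by exists eta => //; split=> //; apply: e2; case: dC.
Qed.

Lemma HH_homologousP c c' : adic_chains A c -> adic_chains A c' ->
  HH_homologous A (adic_chains A) c c' <-> forall k, c (epsw k) = c' (epsw k).
Proof.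
move=> ca ca'; split=> [[eta _ cc] k|cc].
  apply/eqP; rewrite -subr_eq0; apply/eqP.
  have := congr1 (fun c : chain R gen => c (epsw k)) cc.
  by rewrite apply_bE_epsw !fctE.
pose D : uchain R gen := fun l => if l == 0 then c - c' else 0.
have DC : CCpow (adic_chains A) D.
  split=> [l|l l0]; rewrite /D; case: eqP => lE //.
  - exact: adic_chainsB.
  - exact: adic_chains0.
  - by move: l0; rewrite lE ltxx.
have [|eta [[ea _] DE D0]] := bB_surj (CCpow_laurent DC).
  by move=> l k; rewrite /D; case: eqP => // _; rewrite !fctE cc subrr.
exists (eta 0); first exact: ea.
have -> : c - c' = D 0 by [].
rewrite DE; apply/funext => y; rewrite /bB.
have -> : eta (0 - 1) = 0 by apply: D0 => //; case: DC.
have [/reducedP[]->|yn] := boolP (reduced A y).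
- by rewrite apply_BE_epsw addr0.
- by rewrite apply_BE_onew mulr0 addr0.
- by rewrite !apply_nonreduced ?addr0.
Qed.

Lemma HP_homologousP z w :
  adic_laurent A (z - w) -> epart z = epart w -> HP_homologous A z w.
Proof.
move=> zwa zw; have [|eta [ea zwE _]] := bB_surj zwa; last by exists eta.
move=> l k; have := congr1 (fun c : int -> nat -> R => c l k) zw.
by rewrite /epart !fctE => ->; rewrite subrr.
Qed.

Lemma HCm_cycleP z : CCpow (adic_chains A) z ->
  HCm_cycle A (adic_chains A) z <-> forall l m, tw (epart z) l m = 0.
Proof.
move=> zC; split=> [[_ bz] l m|tz].
  by rewrite -(bB_onew _ _ _ versal_pot_big) bz.
split=> //; apply/funext => l; apply: (chain_ext (T := versal_pot)) => [y yn|k|k].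
- by rewrite bB_nonreduced.
- by rewrite bB_epsw.
- by rewrite (bB_onew _ _ _ versal_pot_big) tz.
Qed.

(** * The cycle zeta *)

(** For a cycle, having this initial part is the same as being the expansion in
1/x of (W' - u d/dx)^(-1) (1), whose leading term is x^(-n). *)
Lemma zeta_exists : exists x : int -> nat -> R,
  (forall l k, (k < n)%N -> x l k = ((l == 0) && (k == n.-1))%:R) /\
  (forall l m, tw x l m = 0).
Proof. exact: (twisted_solve n_gt0 Wn _ (fun _ _ => 0)). Qed.

Definition zcoef := sval (cid zeta_exists).

Lemma zcoef_init l k : (k < n)%N -> zcoef l k = ((l == 0) && (k == n.-1))%:R.
Proof. by rewrite /zcoef; case: cid => x [] /= + _; apply. Qed.

Lemma zcoef_twisted l m : tw zcoef l m = 0.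
Proof. by rewrite /zcoef; case: cid => x [_] /=; apply. Qed.

Lemma zcoef_rec l m : zcoef l (m + n)%N =
  - (\sum_(i < n) W i * zcoef l (m + i)%N + m%:R * zcoef (l - 1) m.-1).
Proof. by rewrite (twisted_rec Wn) zcoef_twisted sub0r. Qed.

Lemma zcoef_neg l k : (l < 0)%R -> zcoef l k = 0.
Proof.
move=> l0; apply: (@max_pow_inf n K) => N.
apply: (twisted_max_pow (l0 := 0) n_gt0 Wn) l0 => {k}l.
  move=> k l0 kn; rewrite zcoef_init // (_ : l == 0 = false); last by lia.
  exact: max_pow_zero.
by move=> m ll; rewrite zcoef_twisted; apply: max_pow_zero.
Qed.

(** The zone k < n - 1 + (n + 1) l is stable under the recursion: [m + i] stays in
it for the same [l], and [m - 1] = (m + n) - (n + 1) for [l - 1]. *)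
Lemma zcoef_supp (l k : nat) : (k < n.-1 + n.+1 * l)%N -> zcoef l%:Z k = 0.
Proof.
move=> kl; move: {1 3}(l%:Z) (erefl l%:Z) => l'.
elim/(twisted_ind n_gt0) : l' / k l kl => [l' k kn l kl|l' m IHl IHp l kl] lE.
  rewrite zcoef_init // (_ : _ && _ = false) //; lia.
rewrite zcoef_rec big1 => [|i _]; last first.
  by rewrite (IHl i (ltn_ord i) l) ?mulr0 //; have := ltn_ord i; lia.
case: m kl IHl IHp => [|m] kl IHl IHp; first by rewrite mul0r addr0 oppr0.
case: l kl lE => [|l] kl lE.
  by rewrite zcoef_neg ?mulr0 ?addr0 ?oppr0 //; lia.
rewrite (IHp isT l) ?mulr0 ?addr0 ?oppr0 //; last by lia.
by move: kl; rewrite mulnS /=; lia.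
Qed.

Lemma zcoef_laurent : laurent_seq zcoef.
Proof.
apply: (twisted_laurent n_gt0 Wn W1) => [N|].
  exists 0 => l k l0 kn; rewrite zcoef_neg //; exact: max_pow_zero.
split=> [l N|N].
  by exists 0%N => k _; rewrite zcoef_twisted; apply: max_pow_zero.
by exists 0 => l k _; rewrite zcoef_twisted; apply: max_pow_zero.
Qed.

Definition zeta0 : uchain R gen := fun l y =>
  if is_eps y.1 && reduced A y then zcoef l (size y.2) else 0.

Lemma epart_zeta0 : epart zeta0 = zcoef.
Proof.
apply/funext => l; apply/funext => k.
by rewrite /epart /zeta0 reduced_epsw /= size_nseq.
Qed.

Lemma zeta0_CCpow : CCpow (adic_chains A) zeta0.
Proof.
split=> [l|l l0]; last first.
  by apply/funext => y; rewrite /zeta0 zcoef_neg // if_same.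
apply/adic_chainsP; split=> [y yn|N|N].
- by rewrite /zeta0 (negbTE yn) andbF.
- have [k0 H] := zcoef_laurent.1 l N; exists k0 => k kk.
  by rewrite -/(epart zeta0 l k) epart_zeta0; apply: H.
- by exists 0%N => k _; apply: max_pow_zero.
Qed.

Lemma zeta0_cycle : HCm_cycle A (adic_chains A) zeta0.
Proof.
by apply/(HCm_cycleP zeta0_CCpow) => l m; rewrite epart_zeta0 zcoef_twisted.
Qed.

End Versal.

(** * The Euler field and the connections *)

Lemma apply0 (R : comNzRingType) (I : finType) (A : ainf R I) op :
  apply A op 0 = 0.
Proof.
apply/funext => y; rewrite /apply; case: ifP => // _.
by apply: fsbig1 => x _; rewrite mul0r.
Qed.

Lemma mps_intZ (K : fieldType) n (l : int) (f : mps n K) :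
  l%:~R * f = (l%:~R : K) *: f.
Proof. by rewrite mulrzl scaler_int. Qed.

Lemma adic_seq_derivation (K : fieldType) n (v : mps n K -> mps n K) s :
  [pchar K] =i pred0 ->
  derivation v -> adic_seq s -> adic_seq (fun k => v (s k)).
Proof.
move=> charK dv sa N; have [k0 H] := sa N.+1; exists k0 => k kk.
by apply: derivation_max_pow => //; apply: H.
Qed.

Section Versal.
Variables (K : fieldType) (n : nat).
Local Notation R := (mps n K).
Local Notation T := (@versal_pot K n).
Local Notation A := (eps_ainf T).
Local Notation W := (dpot T).
Local Notation tw := (twisted n W).
Implicit Types (z : uchain R gen) (v E : R -> R).

(** The weight of a monomial, in units of 1/(n + 1). *)
Definition weight (m : 'X_{1..n}) : nat := \sum_(i < n) m i * (n.+1 - i).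

Definition euler : R -> R := diag_op (fun m => (weight m)%:R / n.+1%:R).

Lemma weightD m m' : weight (m + m')%MM = (weight m + weight m')%N.
Proof.
by rewrite /weight -big_split; apply: eq_bigr => i _; rewrite mnmDE mulnDl.
Qed.

Lemma weight_eq0 m : weight m = 0%N -> m = 0%MM.
Proof.
move/eqP; rewrite sum_nat_eq0 => /forallP H; apply/mnmP => i.
by have := H i; rewrite muln_eq0 mnm0E => /orP[/eqP//|]; have := ltn_ord i; lia.
Qed.

Lemma weight0 : weight 0%MM = 0%N.
Proof. by rewrite /weight big1 // => i _; rewrite mnm0E. Qed.

Lemma weightU i : weight U_(i)%MM = (n.+1 - i)%N.
Proof.
rewrite /weight (bigD1 i) //= mnm1E eqxx mul1n big1 ?addn0 // => j ji.
by rewrite mnm1E eq_sym (negbTE ji).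
Qed.

Lemma euler_derivation : derivation euler.
Proof.
by apply: diag_derivation => m m'; rewrite weightD natrD mulrDl.
Qed.

(** For E with this property E(W) = W - x W'/(n + 1), in accordance with the
weight 1/(n + 1) of x. *)
Definition euler_field E :=
  forall k, E (T k) = ((n.+1 - k)%:R / n.+1%:R) *: T k.

Lemma euler_var (i : 'I_n) :
  euler (mps_var K i) = ((n.+1 - i)%:R / n.+1%:R) *: mps_var K i.
Proof.
apply: mpsP => m /=; case: eqP => [->|_]; rewrite ?mulr0 //.
by rewrite weightU.
Qed.

Lemma derivation_pot_big v k : derivation v -> (n <= k)%N -> v (T k) = 0.
Proof.
move=> dv nk; have [->|kn] := eqVneq k n.+1.
  by rewrite versal_pot_top derivation_const.
by rewrite versal_pot0 // derivation0.
Qed.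

Lemma euler_fieldP E : derivation E ->
  (forall i : 'I_n, E (mps_var K i) = ((n.+1 - i)%:R / n.+1%:R) *: mps_var K i)
  -> euler_field E.
Proof.
move=> dE Evar k; have [kn|nk] := ltnP k n.
  by rewrite (versal_pot_var K (Ordinal kn)) Evar.
rewrite derivation_pot_big //; have [->|kn] := eqVneq k n.+1.
  by rewrite subnn mul0r scale0r.
by rewrite versal_pot0 // scaler0.
Qed.

Lemma euler_euler_field : euler_field euler.
Proof. by apply: euler_fieldP euler_derivation _ => i; apply: euler_var. Qed.

Lemma deriv_muE v k s : derivation v ->
  deriv_mu A v (nseq k eps) s = if s is e1 then v (T k) else 0.
Proof.
move=> dv; rewrite /deriv_mu /= eps_mu_nseq; case: s => //.
exact: derivation0.
Qed.

Lemma kappaE k s :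
  kappa A (nseq k eps) s = if s is e1 then (2 - k%:R : K) *: T k else 0.
Proof.
rewrite /kappa /= eps_mu_nseq size_nseq; case: s; rewrite ?mulr0 //.
by rewrite mulrBl !mps_natZ -scalerBl.
Qed.

Hypothesis charK : [pchar K] =i pred0.
Local Notation nK := (nK_neq0 n charK).

Lemma euler_field_unique E : derivation E -> euler_field E -> E =1 euler.
Proof.
move=> dE Ef; apply: (derivation_ext charK dE euler_derivation) => i.
by rewrite euler_var -versal_pot_var Ef.
Qed.

Lemma euler_coef k :
  ((n.+1 - k)%:R / n.+1%:R) *: T k = T k - (k%:R / n.+1%:R) *: T k.
Proof.
have [kn|nk] := leqP k n.+1; last by rewrite versal_pot_big // !scaler0 subr0.
by rewrite natrB // mulrBl divff ?nK // scalerBl scale1r.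
Qed.

(** The bounding cochain psi(x) = - x/(n + 1) comes from
E(W) - W = - x W'/(n + 1). *)
Lemma cohomologous_euler E : derivation E ->
  euler_field E -> cohomologous A (deriv_mu A E) (mu A).
Proof.
move=> dE Ef; pose psi : cochain R gen := fun w s =>
  if (w == [:: eps]) && (s == eps) then - mps_const n (n.+1%:R^-1) else 0.
have psir : cochain_reduced A psi.
  by move=> w s; rewrite /psi; case: eqP => // ->.
exists psi => // w s /e1_notinP ->; move: (size w) => k.
rewrite deriv_muE // [mu A _ _]eps_mu_nseq; case: s; last first.
  rewrite hdelta_eps ?subrr // => w'; rewrite /psi andbF //.
rewrite hdelta_e1 // Ef euler_coef addrAC subrr add0r.
case: k => [|k].
  by rewrite big_ord1 /psi /= mul0r mul0r scale0r oppr0.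
have k1 : (1 < k.+2)%N by [].
rewrite (@sum_only1 _ _ (Ordinal k1)) //; last first.
  move=> i _ i1; rewrite /psi; case: eqP => [|_]; last by rewrite mul0r.
  move/(congr1 size); rewrite size_nseq => iE.
  by case/eqP: i1; apply/val_inj.
rewrite /psi /= subn1 /= mulNr mps_const_scale -mps_scaleAl mul1r /dpot.
rewrite mps_natZ scalerA.
by rewrite mulrC.
Qed.

(** Uniqueness in Weierstrass division: a multiple of W' of degree < n vanishes.
Modulo the maximal ideal W' is x^n, so each comparison of the coefficients in
degrees >= n pushes the quotient into the next power of the ideal. *)
Lemma weierstrass_eq0 (chi : nat -> R) :
  (forall k, (n <= k)%N -> \sum_(i < k.+1) chi i * W (k - i) = 0) ->
  forall i, chi i = 0.
Proof.
move=> chi0 i; apply: (@max_pow_inf n K) => N; elim: N i => [//|N IH] i.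
have := chi0 (i + n)%N (leq_addl _ _).
have i1 : (i < (i + n).+1)%N by lia.
rewrite (bigD1 (Ordinal i1)) //= addKn Wn // mulr1 => /eqP.
rewrite addr_eq0 => /eqP ->; apply/max_powN/max_pow_sum => j ji.
have [jl|jg] := ltnP j i.
  by rewrite (dpot0 (@versal_pot_big K n)) ?mulr0; [exact: max_pow_zero|lia].
rewrite -addn1; apply: max_powM => //; apply: W1.
have : (j : nat) != i by apply: contraNneq ji => jE; apply/eqP/val_inj.
have := ltn_ord j; lia.
Qed.

(** E(W) and W - x W'/(n + 1) are congruent modulo W' and both have degree < n. *)
Lemma cohomologous_unique E : derivation E ->
  cohomologous A (deriv_mu A E) (mu A) -> euler_field E.
Proof.
move=> dE [psi psir psiE] k; apply/eqP; rewrite -subr_eq0; apply/eqP.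
(* the quotient of E(W) - (W - x W'/(n + 1)) by W' *)
pose chi i := psi (nseq i eps) eps + (i == 1)%:R * mps_const n (n.+1%:R^-1).
have chiE j : E (T j) - ((n.+1 - j)%:R / n.+1%:R) *: T j =
    \sum_(i < j.+1) chi i * W (j - i).
  have := psiE (nseq j eps) e1 (e1_notin_nseq j).
  rewrite deriv_muE // [mu A _ _]eps_mu_nseq hdelta_e1 // => /eqP.
  rewrite subr_eq => /eqP ->; rewrite euler_coef opprB addrA addrAC addrK.
  under [RHS]eq_bigr => i _ do rewrite mulrDl.
  rewrite big_split /=; congr (_ + _).
  case: j => [|j]; first by rewrite big_ord1 /= !mul0r scale0r.
  have k1 : (1 < j.+2)%N by [].
  rewrite (@sum_only1 _ _ (Ordinal k1)) //; last first.
    move=> i _ i1; case: eqP => [iE|_]; last by rewrite !mul0r.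
    by case/eqP: i1; apply/val_inj.
  rewrite /= subn1 /= mul1r mps_const_scale -mps_scaleAl mul1r /dpot.
  rewrite mps_natZ scalerA.
  by rewrite mulrC.
have chi0 : forall i, chi i = 0.
  apply: weierstrass_eq0 => j nj; rewrite -chiE derivation_pot_big // sub0r.
  have [->|jn] := eqVneq j n.+1; first by rewrite subnn mul0r scale0r oppr0.
  by rewrite versal_pot0 // scaler0 oppr0.
by rewrite chiE big1 // => i _; rewrite chi0 mul0r.
Qed.

Lemma nablaE v z l a m : derivation v ->
  nabla A v z l (a, nseq m eps) = v (z l (a, nseq m eps)) -
    \sum_(i < n) v (T i) * z (l + 1) (a, nseq (m + i) eps).
Proof.
move=> dv; rewrite /nabla (apply_B11E _ (fun k s => deriv_muE k s dv)) subr0.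
rewrite (apply_b11E _ (fun k s => deriv_muE k s dv) (N := n)) // => k nk.
exact: derivation_pot_big.
Qed.

Lemma unablaE v z l a m : derivation v ->
  unabla A v z l (a, nseq m eps) = v (z (l - 1) (a, nseq m eps)) -
    \sum_(i < n) v (T i) * z l (a, nseq (m + i) eps).
Proof. by move=> dv; rewrite /unabla /umul nablaE // subrK. Qed.

Lemma nabla_duE z l a m :
  unabla_du A z l (a, nseq m eps) = (l%:~R - m%:R / 2) *: z l (a, nseq m eps)
   + \sum_(i < n.+2) (1 - i%:R / 2) *: (T i * z (l + 1) (a, nseq (m + i) eps)).
Proof.
rewrite /unabla_du /umul /nabla_du subrK (_ : l - 1 + 2 = l + 1); last by lia.
rewrite (apply_B11E _ kappaE) addr0 /Gamma /= size_nseq mps_intZ mps_natZ.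
rewrite (apply_b11E _ kappaE (N := n.+2)); last first.
  by move=> k nk; rewrite versal_pot_big ?scaler0.
rewrite scalerDr scalerN scalerA addrA scalerBl mulrC; congr (_ + _).
rewrite scaler_sumr; apply: eq_bigr => i _.
rewrite -mps_scaleAl scalerA; congr (_ *: _).
rewrite mulrBr mulVf ?[_ * i%:R]mulrC //.
exact: (natS_neq0 charK 1).
Qed.

(** The part in 1/u of the left-hand side is multiplication by
(2 W - x W')/2 - (W - x W'/(n + 1)), a multiple of x W'; on a cycle x W' acts
as u x d/dx, which is diagonal. *)
Lemma euler_connection z E l k : derivation E -> euler_field E ->
  (forall l m, tw (epart z) l m = 0) ->
  (unabla_du A z + nabla A E z) l (epsw k) =
  (l%:~R + 2^-1 - k.+1%:R / n.+1%:R) *: z l (epsw k) + E (z l (epsw k)).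
Proof.
move=> dE Ef tz.
have -> : (unabla_du A z + nabla A E z) l (epsw k) =
  unabla_du A z l (epsw k) + nabla A E z l (epsw k) by [].
rewrite nabla_duE nablaE //.
have -> : \sum_(i < n) E (T i) * z (l + 1) (eps, nseq (k + i) eps) =
   \sum_(i < n.+2) (1 - i%:R / n.+1%:R) *: (T i * z (l + 1) (epsw (k + i))).
  rewrite 2!big_ord_recr /= divff ?nK // subrr scale0r addr0.
  rewrite versal_pot0 //; last by lia.
  rewrite mul0r scaler0 addr0; apply: eq_bigr => i _.
  by rewrite Ef euler_coef mulrBl -mps_scaleAl scalerBl scale1r.
have cyc := tz (l + 1) k.+1.
have {cyc} : \sum_(i < n.+2) i%:R *: (T i * z (l + 1) (epsw (k + i))) =
    - (k.+1%:R *: z l (epsw k)).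
  apply/eqP; rewrite -addr_eq0; apply/eqP; rewrite -[RHS]cyc /twisted.
  rewrite big_ord_recl scale0r add0r addrK mps_natZ; congr (_ + _).
  by apply: eq_bigr => i _; rewrite mps_scaleAl -mps_natZ /epart addSnnS.
move=> cyc.
rewrite addrACA -sumrB; under eq_bigr => i _ do rewrite -scalerBl.
have -> : \sum_(i < n.+2) (1 - i%:R / 2 - (1 - i%:R / n.+1%:R))
      *: (T i * z (l + 1) (epsw (k + i))) =
   (n.+1%:R^-1 - 2^-1) *: \sum_(i < n.+2) i%:R *: (T i * z (l + 1) (epsw (k + i))).
  rewrite scaler_sumr; apply: eq_bigr => i _; rewrite scalerA; congr (_ *: _).
  by move: (n.+1%:R^-1) => a; ring.
rewrite cyc scalerN scalerA addrAC -scalerBl; congr (_ *: _ + _).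
by rewrite -natr1; move: (n.+1%:R^-1) (2^-1) => a b; ring.
Qed.

Lemma euler_dpot i :
  euler (W i) = ((n - i)%:R / n.+1%:R) *: W i.
Proof.
rewrite /dpot mps_natZ (derivationZ euler_derivation).
by rewrite euler_euler_field subSS !scalerA mulrC.
Qed.

Hypothesis n_gt0 : (0 < n)%N.
Local Notation zcoef := (zcoef charK n_gt0).

Lemma zcoef_euler l k :
  euler (zcoef l k) = (k.+1%:R / n.+1%:R - n%:R / n.+1%:R - l%:~R) *: zcoef l k.
Proof.
have n0 := nK; have dE := euler_derivation.
move: l k; apply: (twisted_ind n_gt0) => [l k kn|l m IHl IHp].
  rewrite zcoef_init //; case: eqP => [->|_] /=; last first.
    by rewrite derivation0 // scaler0.
  case: eqP => [->|_] /=; last by rewrite derivation0 // scaler0.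
  by rewrite derivation1 // prednK // subrr subr0 scale0r.
rewrite zcoef_rec (derivationN dE) (derivationD dE) (derivation_sum dE) scalerN.
congr (- _); rewrite scalerDr scaler_sumr; congr (_ + _).
  apply: eq_bigr => i _; have ilt := ltn_ord i.
  rewrite (derivationM dE) IHl // euler_dpot.
  rewrite -mps_scaleAl -mps_scaleAr -scalerDl; congr (_ *: _).
  by rewrite natrB ?(ltnW ilt) //; move: (n.+1%:R^-1) => a; ring.
case: m IHp {IHl} => [|m] IHp.
  by rewrite !mul0r (derivation0 dE) scaler0.
rewrite !mps_natZ (derivationZ dE) (IHp isT) !scalerA; congr (_ *: _).
rewrite mulrC; congr (_ * _).
have -> : (m.+1 + n).+1%:R = m.+1%:R + n.+1%:R :> K by ring.
by rewrite mulrDl divff // intrB; ring.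
Qed.

End Versal.

(** * Existence and uniqueness of the primitive form *)

Section Primitive.
Variables (K : fieldType) (n : nat).
Hypotheses (charK : [pchar K] =i pred0) (n_gt0 : (0 < n)%N).
Local Notation R := (mps n K).
Local Notation T := (@versal_pot K n).
Local Notation A := (eps_ainf T).
Local Notation W := (dpot T).
Local Notation tw := (twisted n W).
Local Notation zcoef := (zcoef charK n_gt0).
Implicit Types (z : uchain R gen) (v E : R -> R).

Definition central_pot (k : nat) : K := if k == n.+1 then n.+1%:R^-1 else 0.
Local Notation A0 := (eps_ainf central_pot).

Lemma coefs_pot k : coefs (T k) 0%MM = central_pot k.
Proof.
rewrite /versal_pot /central_pot; case: eqP => _; first by rewrite /= eqxx.
case: insubP => [i _ _|_]; last exact: coefs0.
by apply: (@max_pow_var n K i); rewrite mdeg0.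
Qed.

Lemma coefs_natM k (f : R) m : coefs (k%:R * f) m = k%:R * coefs f m.
Proof. by rewrite mps_natZ. Qed.

Lemma coefs_nat k : coefs (k%:R : R) 0%MM = k%:R.
Proof. by rewrite coefsMn coefs1 eqxx. Qed.

Lemma coefs_dpot i : coefs (W i) 0%MM = dpot central_pot i.
Proof. by rewrite /dpot coefs_natM coefs_pot. Qed.

Lemma coefs_twisted (x : int -> nat -> R) l m :
  coefs (tw x l m) 0%MM =
  twisted n (dpot central_pot) (fun l k => coefs (x l k) 0%MM) l m.
Proof.
rewrite /twisted coefsD coefs_sum coefs_natM; congr (_ + _).
by apply: eq_bigr => i _; rewrite coefsM0 coefs_dpot.
Qed.

Lemma zcoef_central l k : coefs (zcoef l k) 0%MM = omega K n l (epsw k).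
Proof.
have oE (l' : nat) j : omega K n l' (epsw j) =
    (-1) ^+ l' * omega_coef K n l' * (j == n.-1 + n * l' + l')%N%:R.
  by rewrite /omega -(inj_eq epsw_inj).
move: l k; apply: (twisted_ind n_gt0) => [l k kn|l m IHl IHp].
  rewrite zcoef_init // coefs_nat; case: l => [l|l] //; rewrite oE.
  case: l => [|l].
    by rewrite expr0 mul1r /omega_coef big_ord0 mul1r muln0 !addn0.
  rewrite [in RHS](_ : (k == _) = false) ?mulr0 //; lia.
rewrite zcoef_rec // coefsN coefsD coefs_sum coefs_natM big1 ?add0r; last first.
  move=> i _; rewrite coefsM0 (W1 K (ltn_ord i)) ?mul0r //; by rewrite mdeg0.
case: l IHp {IHl} => [l|l] IHp; last first.
  by rewrite zcoef_neg ?coefs0 ?mulr0 ?oppr0.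
rewrite oE; case: l IHp => [|l] IHp.
  rewrite zcoef_neg // coefs0 mulr0 oppr0 (_ : (_ == _) = false) ?mulr0 //; lia.
case: m IHp => [|m] IHp.
  rewrite mul0r oppr0 (_ : (_ == _) = false) ?mulr0 //; lia.
rewrite IHp // (_ : Posz l.+1 - 1 = l); last by lia.
rewrite [m.+1.-1]/= oE.
rewrite (_ : (m.+1 + n == _)%N = (m == n.-1 + n * l + l)%N); last by lia.
case: eqP => [mE|_]; last by rewrite !mulr0 oppr0.
rewrite /omega_coef big_ord_recr /= exprS !mulr1.
rewrite (_ : m.+1 = (n + l * n.+1)%N); last by lia.
ring.
Qed.

Lemma adic_connection v l c : derivation v -> (forall l, adic_chains A (c l)) ->
  adic_chains A (unabla A v c l).
Proof.
move=> dv ca; have /adic_chainsP[c0 cE cU] := ca l.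
have /adic_chainsP[c0' cE' cU'] := ca (l - 1).
apply/adic_chainsP; split=> [y yn||].
- by rewrite /unabla /umul /nabla c0' // !apply_nonreduced // derivation0 // !subr0.
- apply: adic_seq_mono (adic_seqB (adic_seq_derivation charK dv cE')
    (@adic_seq_sum n K n (fun i k => v (T i) * c l (epsw (k + i))) _)) _.
    by move=> i; apply: adic_seqM; apply: (adic_seq_shift i cE).
  by move=> N k; rewrite [unabla _ _ _ _ _]unablaE.
- apply: adic_seq_mono (adic_seqB (adic_seq_derivation charK dv cU')
    (@adic_seq_sum n K n (fun i k => v (T i) * c l (onew (k + i))) _)) _.
    by move=> i; apply: adic_seqM; apply: (adic_seq_shift i cU).
  by move=> N k; rewrite [unabla _ _ _ _ _]unablaE.
Qed.

Lemma adic_connection_u l c : (forall l, adic_chains A (c l)) ->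
  adic_chains A (unabla_du A c l).
Proof.
move=> ca; have /adic_chainsP[c0 cE cU] := ca l.
have /adic_chainsP[c0' cE' cU'] := ca (l + 1).
have key a : adic_seq (fun k => c l (a, nseq k eps)) ->
    adic_seq (fun k => c (l + 1) (a, nseq k eps)) ->
    adic_seq (fun k => unabla_du A c l (a, nseq k eps)).
  move=> ha ha'.
  have h1 : adic_seq (fun k =>
      mps_const n (l%:~R - k%:R / 2) * c l (a, nseq k eps)) by apply: adic_seqM.
  have h2 : adic_seq (fun k => \sum_(i < n.+2)
      mps_const n (1 - i%:R / 2) * (T i * c (l + 1) (a, nseq (k + i) eps))).
    apply: (@adic_seq_sum n K n.+2 (fun i k =>
      mps_const n (1 - i%:R / 2) * (T i * c (l + 1) (a, nseq (k + i) eps)))).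
    by move=> i; do 2!apply: adic_seqM; apply: (adic_seq_shift i ha').
  apply: adic_seq_mono (adic_seqD h1 h2) _ => N k; rewrite nabla_duE //.
  rewrite mps_const_scale -mps_scaleAl mul1r.
  by under eq_bigr => i _ do rewrite mps_const_scale -mps_scaleAl mul1r.
apply/adic_chainsP; split=> [y yn||]; [|exact: key|exact: key].
have /adic_chainsP[c0'' _ _] := ca (l - 1 + 1).
rewrite /unabla_du /umul /nabla_du /Gamma c0'' // !apply_nonreduced //.
by rewrite !mulr0 oppr0 !addr0 scaler0 addr0.
Qed.

(** The columns are in reverse order, which makes the matrix lower triangular. *)
Definition hankel : 'M[R]_n := \matrix_(k, j) zcoef 0 (k + (n.-1 - j))%N.

Lemma det_hankel : \det hankel = 1.
Proof.
rewrite det_trig; last first.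
  apply/is_trig_mxP => k j kj; have jn := ltn_ord j.
  rewrite mxE zcoef_init; last by lia.
  by rewrite (_ : (_ == n.-1)%N = false) //; lia.
rewrite big1 // => k _; rewrite mxE zcoef_init; last by have := ltn_ord k; lia.
by rewrite (_ : (_ == n.-1)%N = true) //; have := ltn_ord k; lia.
Qed.

Lemma hankel_sum (a : 'I_n -> R) (k : 'I_n) :
  \sum_i a i * zcoef 0 (k + i)%N = (hankel *m (\col_j a (rev_ord j))) k ord0.
Proof.
rewrite mxE (reindex_inj rev_ord_inj) /=; apply: eq_bigr => i _.
by rewrite !mxE mulrC; congr (zcoef _ _ * _); have := ltn_ord i; lia.
Qed.

Lemma hankel_solve (c : nat -> R) : exists a : 'I_n -> R,
  forall k : 'I_n, \sum_i a i * zcoef 0 (k + i)%N = c k.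
Proof.
pose b := \adj hankel *m (\col_k c (val k)).
exists (fun i => b (rev_ord i) ord0) => k; rewrite hankel_sum.
rewrite (_ : \col_j _ = b); last by apply/colP => j; rewrite mxE rev_ordK.
by rewrite /b mulmxA mul_mx_adj det_hankel mul1mx mxE.
Qed.

Lemma hankel_inj (a : 'I_n -> R) :
  (forall k : 'I_n, \sum_i a i * zcoef 0 (k + i)%N = 0) -> forall i, a i = 0.
Proof.
move=> a0 i; have : hankel *m (\col_j a (rev_ord j)) = 0.
  by apply/colP => k; rewrite -hankel_sum a0 mxE.
move/(congr1 (mulmx (\adj hankel))); rewrite mulmx0 mulmxA mul_adj_mx.
rewrite det_hankel mul1mx => /colP/(_ (rev_ord i)).
by rewrite !mxE rev_ordK.
Qed.

(** As W' is monic of degree n, the kernel equation at [m] expresses the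
coefficient [m + n] through the previous ones. *)
Lemma kernel_ext (c c' : nat -> R) :
  (forall m, \sum_(i < n.+1) W i * c (m + i)%N = 0) ->
  (forall m, \sum_(i < n.+1) W i * c' (m + i)%N = 0) ->
  (forall k, (k < n)%N -> c k = c' k) -> forall k, c k = c' k.
Proof.
move=> cW cW' cc; elim/ltn_ind => k IH.
have [kn|nk] := ltnP k n; first exact: cc.
have := etrans (cW (k - n)%N) (esym (cW' (k - n)%N)).
rewrite !big_ord_recr /= Wn // !mul1r subnK //.
rewrite (eq_bigr (fun i : 'I_n => W i * c' (k - n + i)%N)) => [/addrI//|i _].
by rewrite IH //; have := ltn_ord i; lia.
Qed.

Lemma zcoef_kernel m : \sum_(i < n.+1) W i * zcoef 0 (m + i)%N = 0.
Proof.
have := zcoef_twisted charK n_gt0 0 m.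
by rewrite /twisted [zcoef (0 - 1) _]zcoef_neg // mulr0 addr0.
Qed.

Lemma vector_field_pot (a : 'I_n -> R) (i : 'I_n) :
  \sum_j a j * partial j (T i) = a i.
Proof. by rewrite versal_pot_var vector_field_var. Qed.

Lemma derivation_zcoef_init v l k : derivation v -> (k < n)%N -> v (zcoef l k) = 0.
Proof.
move=> dv kn; rewrite zcoef_init //; case: (_ && _).
  exact: derivation1.
exact: derivation0.
Qed.

(** The action of the grading operator on the leading term eps|eps^(n-1). *)
Definition euler_eigenvalue : K := 2^-1 - n%:R / n.+1%:R.

Section Representative.
Variable z : uchain R gen.
Hypotheses (zC : CCpow (adic_chains A) z) (zE : epart z = zcoef).

Lemma rep_epsw l k : z l (epsw k) = zcoef l k.
Proof. by rewrite -zE. Qed.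

Lemma rep_twisted l m : tw (epart z) l m = 0.
Proof. by rewrite zE zcoef_twisted. Qed.

(** The eps-part of [z] restricts to that of omega. Its 1-part bounds over R, and
the primitive restricts to the central fiber: being adically convergent, it
has finite support modulo the maximal ideal. *)
Lemma rep_P0 : P0 A0 (omega K n) z.
Proof.
pose D : uchain R gen := fun l y => if is_eps y.1 then 0 else z l y.
have Da l : adic_chains A (D l).
  have /adic_chainsP[z0 _ zU] := zC.1 l; apply/adic_chainsP; split=> //.
    by move=> y yn; rewrite /D z0 // if_same.
  exact: adic_seq0.
have DC : CCpow (adic_chains A) D.
  by split=> // l l0; apply/funext => y; rewrite /D zC.2 // if_same.
have [//|eta [[ea _] DE D0]] := bB_surj charK n_gt0 (CCpow_laurent DC).
exists (central_fiber eta).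
  split=> [l|l l0]; last first.
    apply/funext => y; rewrite /central_fiber D0 //; last by case: DC.
    exact: coefs0.
  (* a series outside the maximal ideal is one with a constant term *)
  have [e0 /(_ 1%N) ef] := ea l; split=> [y yn|].
    by rewrite /central_fiber e0 // coefs0.
  apply: sub_finite_set ef => y /= /eqP yn y1; apply: yn.
  by apply: y1; rewrite mdeg0.
apply/funext => l; apply: (chain_ext (T := central_pot)) => [y yn|k|k].
- rewrite bB_nonreduced // !fctE /central_fiber.
  have /adic_chainsP[-> // _ _] := zC.1 l; rewrite coefs0 sub0r.
  case: l => [l|l] /=; last by rewrite oppr0.
  by case: eqP => [yE|_]; [move: yn; rewrite yE reduced_epsw|rewrite mulr0 oppr0].
- by rewrite bB_epsw !fctE /central_fiber rep_epsw zcoef_central subrr.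
have T0 j : (n.+1 < j)%N -> central_pot j = 0.
  by rewrite /central_pot; case: eqP => // ->; rewrite ltnn.
rewrite (bB_onew _ _ _ T0) -coefs_twisted !fctE /central_fiber.
have -> : omega K n l (onew k) = 0 by case: l => // l /=; rewrite mulr0.
by rewrite subr0 -(bB_onew _ _ _ (@versal_pot_big K n)) -DE.
Qed.

Lemma rep_unabla0 v k : derivation v ->
  unabla A v z 0 (epsw k) = - \sum_(i < n) v (T i) * zcoef 0 (k + i)%N.
Proof.
move=> dv; rewrite [LHS]unablaE // zC.2 // derivation0 // sub0r.
by congr (- _); apply: eq_bigr => i _; rewrite -rep_epsw.
Qed.

(** Both sides of the equation for [v] lie in the kernel of W', so that it may be
checked for k < n, where it is a linear system with matrix [hankel]. *)
Lemma rep_P1 : P1 A z.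
Proof.
move=> c [ca bc].
have cW m : \sum_(i < n.+1) W i * c (epsw (m + i)) = 0.
  by rewrite -(apply_bE_onew (@versal_pot_big K n)) bc.
have homP v : derivation v -> HH_homologous A (adic_chains A) (unabla A v z 0) c <->
    forall k, unabla A v z 0 (epsw k) = c (epsw k).
  by move=> dv; apply: HH_homologousP => //; apply: adic_connection dv zC.1.
have [a aE] := hankel_solve (fun k => - c (epsw k)).
pose v f := \sum_i a i * partial i f.
have dv : derivation v by exact: vector_field_derivation.
have vT i : v (T (i : 'I_n)) = a i by exact: vector_field_pot.
exists v; split=> [|v' [dv' /homP - /(_ dv') hv']].
  split=> //; apply/(homP _ dv).
  apply: kernel_ext => // [m|k kn].
    under eq_bigr => j _ do rewrite rep_unabla0 // mulrN mulr_sumr.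
    rewrite sumrN exchange_big big1 ?oppr0 //= => i _.
    under eq_bigr => j _ do rewrite mulrCA addnAC.
    by rewrite -mulr_sumr zcoef_kernel mulr0.
  rewrite rep_unabla0 //; under eq_bigr => i _ do rewrite vT.
  by rewrite (aE (Ordinal kn)) opprK.
apply/funext/(derivation_ext charK dv dv') => i; apply/eqP; rewrite -subr_eq0.
rewrite -versal_pot_var; apply/eqP.
apply: (hankel_inj (a := fun i => v (T i) - v' (T i))) => k.
under eq_bigr => j _ do rewrite mulrBl vT.
rewrite sumrB aE -hv' rep_unabla0 // opprK subrr //.
Qed.

(** The support of [zcoef] leaves room for the n - 1 steps of one multiplication
by v(W). *)
Lemma rep_unabla_supp v (l k : nat) : derivation v -> v (zcoef l k) = 0 ->
  (k < n.+1 * l.+1)%N -> unabla A v z l.+1 (epsw k) = 0.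
Proof.
move=> dv vz kl; rewrite [LHS]unablaE // (_ : Posz l.+1 - 1 = l); last by lia.
rewrite -!/(epsw _) rep_epsw vz sub0r big1 ?oppr0 // => i _.
rewrite -!/(epsw _) rep_epsw zcoef_supp ?mulr0 //; have := ltn_ord i; lia.
Qed.

Lemma rep_unabla_init v (l k : nat) : derivation v -> (0 < l)%N -> (k < n)%N ->
  unabla A v z l (epsw k) = 0.
Proof.
case: l => // l dv _ kn; apply: rep_unabla_supp => //; last by nia.
exact: derivation_zcoef_init.
Qed.

Lemma rep_unabla2_init v v' (l k : nat) : derivation v -> derivation v' ->
  (1 < l)%N -> (k < n)%N -> unabla A v (unabla A v' z) l (epsw k) = 0.
Proof.
case: l => [|[|l]] // dv dv' _ kn.
rewrite [LHS]unablaE // (_ : Posz l.+2 - 1 = l.+1); last by lia.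
rewrite -!/(epsw _) rep_unabla_init // derivation0 // sub0r big1 ?oppr0 // => i _.
have ilt := ltn_ord i.
(* k + i may reach 2n - 2, but the exponent of u is at least 2 *)
rewrite -!/(epsw _) rep_unabla_supp ?mulr0 //; last by nia.
by rewrite zcoef_supp ?derivation0 //; nia.
Qed.

Lemma rep_P2 : P2 A z.
Proof.
move=> v1 v2 d1 d2 l l1; rewrite /hres big1 // => i _.
(* one of the two exponents of u is positive *)
have [i0|i0] := posnP i.
  rewrite (mukai_eq0r (@versal_pot_big K n) n_gt0) ?mulr0 // => k kn.
  by rewrite i0 subn0 rep_unabla_init.
rewrite (mukai_eq0l (@versal_pot_big K n) n_gt0) ?mulr0 // => k kn.
by rewrite rep_unabla_init.
Qed.

Lemma rep_P3 : P3 A z.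
Proof.
move=> v1 v2 v3 d1 d2 d3 l l2; rewrite /hres big1 // => i _.
(* either i >= 2 or l - i >= 1 *)
have [i1|i1] := ltnP 1 i.
  rewrite (mukai_eq0l (@versal_pot_big K n) n_gt0) ?mulr0 // => k kn.
  by rewrite rep_unabla2_init.
rewrite (mukai_eq0r (@versal_pot_big K n) n_gt0) ?mulr0 // => k kn.
by rewrite rep_unabla_init //; lia.
Qed.

Lemma rep_P4 : P4 A z.
Proof.
have dE := euler_derivation K n; have Ef := euler_euler_field K n.
exists (@euler K n); split=> //; first exact: cohomologous_euler.
exists euler_eigenvalue; apply: (HP_homologousP charK n_gt0).
  split=> [l|N].
    apply: adic_chainsB; last by apply: adic_chainsZ; exact: zC.1.
    apply: adic_chainsD; first exact: adic_connection_u zC.1.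
    have -> : nabla A (@euler K n) z l = unabla A (@euler K n) z (l + 1).
      by rewrite /unabla /umul addrK.
    exact: adic_connection dE zC.1.
  exists (-1) => l y l1.
  have z0 : z l = 0 by apply: zC.2; lia.
  have z1 : z (l + 1) = 0 by apply: zC.2; lia.
  rewrite !fctE /unabla_du /umul /nabla_du /nabla /Gamma.
  rewrite subrK (_ : l - 1 + 2 = l + 1); last by lia.
  rewrite z0 z1 !apply0 (_ : (0 : chain R gen) y = 0) //.
  rewrite (derivation0 dE) !mulr0 !scaler0 !subr0 !addr0 oppr0.
  by rewrite scaler0 addr0; apply: max_pow_zero.
apply/funext => l; apply/funext => k.
rewrite /epart euler_connection //; last exact: rep_twisted.
rewrite rep_epsw zcoef_euler -scalerDl; congr (_ *: _).
by rewrite /euler_eigenvalue; move: (n.+1%:R^-1) => a; ring.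
Qed.

End Representative.

(** Comparing the coefficients of each monomial in P4 yields the grading equation
[eigen]; in degree 0 at eps|eps^(n-1), where omega has coefficient 1, it fixes
the constant r. After multiplication by n + 1, the equation for k < n equates a
sum of natural numbers with 0. *)
Lemma primitive_epart z : HCm_cycle A (adic_chains A) z ->
  P0 A0 (omega K n) z -> P4 A z -> epart z = zcoef.
Proof.
move=> zcyc [eta _ z0] [E [dE coE [r [xi _ Er]]]].
have [zC _] := zcyc.
have tz : forall l m, tw (epart z) l m = 0 by apply/(HCm_cycleP zC).
have Ef := cohomologous_unique charK dE coE.
have zomega l k : coefs (epart z l k) 0%MM = omega K n l (epsw k).
  apply/eqP; rewrite -subr_eq0; apply/eqP.
  have := congr1 (fun c : uchain K gen => c l (epsw k)) z0.
  by rewrite bB_epsw.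
have eigen l k m :
    (l%:~R + 2^-1 - k.+1%:R / n.+1%:R + (weight m)%:R / n.+1%:R - r)
      * coefs (epart z l k) m = 0.
  have := congr1 (fun c : uchain R gen => coefs (c l (epsw k)) m) Er.
  rewrite bB_epsw coefs0 !fctE.
  have := euler_connection charK l k dE Ef tz; rewrite !fctE => ->.
  rewrite (euler_field_unique charK dE Ef) coefsB coefsD !coefsZ /= => <-.
  by rewrite /epart; ring.
have rE : r = euler_eigenvalue.
  have := eigen 0 n.-1 0%MM.
  rewrite zomega -zcoef_central zcoef_init ?prednK // !eqxx coefs1 eqxx mulr1.
  by rewrite weight0 mul0r addr0 add0r => /eqP; rewrite subr_eq0 => /eqP.
apply/funext => l; apply/funext => k.
apply: (twisted_inj n_gt0 (Wn n charK)) => {l k} [l k kn|l m]; last first.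
  by rewrite tz zcoef_twisted.
apply: mpsP => m; case: l => [l|l]; last first.
  by rewrite zcoef_neg // /epart zC.2.
have [->|m0] := eqVneq m 0%MM; first by rewrite zomega zcoef_central.
have /eqP := eigen l k m; rewrite rE mulf_eq0 => /orP[/eqP N0|/eqP ->]; last first.
  rewrite zcoef_init //; case: (_ && _); rewrite ?coefs0 // coefs1.
  by rewrite (negbTE m0).
have : (n.+1 * l + (n - k.+1) + weight m)%N%:R = 0 :> K.
  transitivity (n.+1%:R * (l%:~R + 2^-1 - k.+1%:R / n.+1%:R
     + (weight m)%:R / n.+1%:R - euler_eigenvalue)); last by rewrite N0 mulr0.
  have n0 := nK_neq0 n charK; rewrite /euler_eigenvalue !natrD natrM natrB //.
  set a := n.+1%:R^-1; have na : n.+1%:R * a = 1 by rewrite divff.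
  have -> : n.+1%:R * (l%:~R + 2^-1 - k.+1%:R * a + (weight m)%:R * a
    - (2^-1 - n%:R * a)) =
    n.+1%:R * l%:R + (n%:R - k.+1%:R + (weight m)%:R) * (n.+1%:R * a) by ring.
  by rewrite na; ring.
move/eqP; rewrite ((pcharf0P K).1 charK) !addn_eq0 => /andP[_ /eqP /weight_eq0 mE].
by case/eqP: m0.
Qed.

Definition zeta_reps : set (uchain R gen) :=
  [set w | HCm_cycle A (adic_chains A) w /\
           HCm_homologous A (adic_chains A) w (zeta0 charK n_gt0)]%classic.

Fact zeta_repsP : exists2 z, HCm_cycle A (adic_chains A) z &
  zeta_reps = [set w | HCm_cycle A (adic_chains A) w /\
                       HCm_homologous A (adic_chains A) w z]%classic.
Proof. by exists (zeta0 charK n_gt0) => //; apply: zeta0_cycle. Qed.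

Definition zeta_class : HCminus A (adic_chains A) := HCMinus zeta_repsP.

Lemma zeta_class_primitive :
  categorical_primitive_form A0 (omega K n) zeta_class.
Proof.
move=> z [[zC _] /(HCm_homologousP charK n_gt0 zC (zeta0_CCpow charK n_gt0))].
rewrite epart_zeta0 => zE; split.
- exact: rep_P0.
- exact: rep_P1.
- exact: rep_P2.
- exact: rep_P3.
- exact: rep_P4.
Qed.

Lemma HCminus_ext (c c' : HCminus A (adic_chains A)) :
  reps c = reps c' -> c = c'.
Proof.
case: c c' => [r rP] [r' rP'] /= E; rewrite E in rP *.
by rewrite (Prop_irrelevance rP rP').
Qed.

Lemma primitive_form_unique (c : HCminus A (adic_chains A)) :
  categorical_primitive_form A0 (omega K n) c -> zeta_class = c.
Proof.
move=> cprim; have [z zcyc cE] := repsP c.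
have zC := zcyc.1.
have [P0z _ _ _ P4z] : [/\ P0 A0 (omega K n) z, P1 A z, P2 A z, P3 A z & P4 A z].
  by apply: cprim; rewrite cE; split=> //; apply/(HCm_homologousP charK n_gt0).
have zE := primitive_epart zcyc P0z P4z.
apply: HCminus_ext; rewrite cE; apply/funext => w; apply/propext => /=.
split=> -[wcyc hw]; split=> //; move: hw; have wC := wcyc.1.
  move/(HCm_homologousP charK n_gt0 wC (zeta0_CCpow charK n_gt0)).
  by rewrite epart_zeta0 -zE => /(HCm_homologousP charK n_gt0 wC zC).
move/(HCm_homologousP charK n_gt0 wC zC); rewrite zE -(epart_zeta0 charK n_gt0).
by move/(HCm_homologousP charK n_gt0 wC (zeta0_CCpow charK n_gt0)).
Qed.

End Primitive.

Theorem theorem4p3 (K : fieldType) (charK : [pchar K] =i pred0)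
    (n : nat) (n_gt0 : (0 < n)%N) :
  exists! zeta : HCminus (An_versal K n) (adic_chains (An_versal K n)),
    categorical_primitive_form (An K n) (omega K n) zeta.
Proof.
exists (zeta_class charK n_gt0); split; first exact: zeta_class_primitive.
exact: primitive_form_unique.
Qed.
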